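(* Let $(\omega_0,g_0)$ be a hermitian structure, with complex structure $J$, on a real Lie algebra $(\mathfrak g,[\cdot,\cdot])$ of dimension $2n$, with Chern-Ricci form $p_0$ and Chern-Ricci operator $P_0$. Then the Chern-Ricci flow solution (among left-invariant ones) starting at $(\omega_0,g_0)$ is $$\omega(t)=\omega_0-2tp_0=\omega_0((I-2tP_0)\cdot,\cdot),$$ with maximal interval of existence $(T_-,T_+)$ given by: $T_+=\infty$ if $P_0\le0$ and $T_+=1/(2p_+)$ otherwise; $T_-=-\infty$ if $P_0\ge0$ and $T_-=1/(2p_-)$ otherwise, where $p_+$ is the maximum positive eigenvalue of $P_0$ and $p_-$ is the minimum negative eigenvalue of $P_0$. Moreover, the solution to the Chern-Ricci bracket flow $\frac{d}{dt}\mu=\delta_\mu(P_\mu)$, $\mu(0)=[\cdot,\cdot]$, is given by $$\mu(t)=(I-2tP_0)^{1/2}\cdot[\cdot,\cdot],\qquad t\in(T_-,T_+),$$ where $h\cdot[\cdot,\cdot]:=h[h^{-1}\cdot,h^{-1}\cdot]$ for $h\in\mathrm{GL}(\mathfrak g)$.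
   Context: A hermitian structure on a real Lie algebra $\mathfrak g$ of dimension $2n$ is a pair $(\omega,g)$ with $\omega$ a non-degenerate $2$-form and $g$ an inner product such that $J$ defined by $\omega=g(J\cdot,\cdot)$ satisfies $J^2=-I$ and $J$ is integrable, i.e. $[JX,JY]-[X,Y]-J[JX,Y]-J[X,JY]=0$ for all $X,Y$. It is identified with a left-invariant hermitian structure on a Lie group with Lie algebra $\mathfrak g$. Its Chern-Ricci form is $$p(X,Y)=-\tfrac12\mathrm{tr}(J\,\mathrm{ad}[X,Y])+\tfrac12\mathrm{tr}(\mathrm{ad}(J[X,Y])),\qquad X,Y\in\mathfrak g,$$ which is a $(1,1)$-form since $J$ is integrable, and its Chern-Ricci operator $P\in\mathrm{End}(\mathfrak g)$ is defined by $p=\omega(P\cdot,\cdot)$; $P$ is $g$-symmetric and commutes with $J$. The Chern-Ricci flow is $\frac{d}{dt}\omega=-2p$, equivalently $\frac{d}{dt}g=-2p(\cdot,J\cdot)$, for hermitian structures $(\omega(t),g(t))$ on $\mathfrak g$ (with $J$ fixed). For a Lie bracket $\mu$ on the vector space $\mathfrak g$, $P_\mu$ is the Chern-Ricci operator of $(\omega_0,g_0)$ on the Lie algebra $(\mathfrak g,\mu)$, and $\delta_\mu(A):=\mu(A\cdot,\cdot)+\mu(\cdot,A\cdot)-A\mu(\cdot,\cdot)$. *)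

(* Defs.v *)
From mathcomp Require Import all_boot all_order all_algebra.
From mathcomp Require Import all_classical all_reals all_analysis.

Set Implicit Arguments.
Unset Strict Implicit.
Unset Printing Implicit Defensive.

Import Order.TTheory GRing.Theory Num.Theory.
Import numFieldNormedType.Exports.
Import passmx.

Local Open Scope ring_scope.

Section ChernRicci.
Context {R : realType} {V : vectType R}.
Implicit Types (br : V -> V -> V) (om g : V -> V -> R) (J P A h : 'End(V)).

Definition lie_bracket br : Prop :=
  [/\ bilinear_for *:%R *:%R br,
      forall X, br X X = 0 &
      forall X Y Z, br X (br Y Z) + br Y (br Z X) + br Z (br X Y) = 0].

Definition nondegenerate_2form om : Prop :=
  [/\ bilinear_for *%R *%R om,
      forall X, om X X = 0 &
      forall X, (forall Y, om X Y = 0) -> X = 0].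

Definition inner_product g : Prop :=
  [/\ bilinear_for *%R *%R g,
      forall X Y, g X Y = g Y X &
      forall X, X != 0 -> 0 < g X X].

Definition integrable_complex br J : Prop :=
  forall X Y, br (J X) (J Y) - br X Y - J (br (J X) Y) - J (br X (J Y)) = 0.

(* [J] is determined by [om] and [g] through the third clause. *)
Definition hermitian_structure br J om g : Prop :=
  [/\ nondegenerate_2form om, inner_product g,
      forall X Y, om X Y = g (J X) Y,
      forall X, J (J X) = - X & integrable_complex br J].

Definition lftrace A : R :=
  \tr (mxof (vbasis {:V}%VS) (vbasis {:V}%VS) A).

Definition ad br (X : V) : 'End(V) := linfun (br X).

(* The form depends on the hermitian structure only through [J]. *)
Definition chern_ricci_form br J (X Y : V) : R :=
  - (2^-1 * lftrace (J \o ad br (br X Y))%VF)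
  + 2^-1 * lftrace (ad br (J (br X Y))).

(* As [om] is non-degenerate, there is exactly one such [P]. *)
Definition chern_ricci_operator br J om P : Prop :=
  forall X Y, chern_ricci_form br J X Y = om (P X) Y.

(* An operator that is meant to be [g]-symmetric is compared with 0 through
   its quadratic form. *)
Definition nonpos_operator g P : Prop := forall X, g (P X) X <= 0.
Definition nonneg_operator g P : Prop := forall X, 0 <= g (P X) X.

Definition max_pos_eigenvalue P (a : R) : Prop :=
  [/\ 0 < a, leigenvalue P a &
      forall c, 0 < c -> leigenvalue P c -> c <= a].

Definition min_neg_eigenvalue P (a : R) : Prop :=
  [/\ a < 0, leigenvalue P a &
      forall c, c < 0 -> leigenvalue P c -> a <= c].

Definition is_T_plus g P (T : \bar R) : Prop :=
  (nonpos_operator g P -> T = +oo%E) /\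
  (~ nonpos_operator g P ->
     exists2 a, max_pos_eigenvalue P a & T = (1 / (2 * a))%:E).

Definition is_T_minus g P (T : \bar R) : Prop :=
  (nonneg_operator g P -> T = -oo%E) /\
  (~ nonneg_operator g P ->
     exists2 a, min_neg_eigenvalue P a & T = (1 / (2 * a))%:E).

(* Curves are total functions of [t : R]; the flow equations constrain them on
   the open interval ]a, b[ only, whose endpoints may be infinite. *)
Definition chern_ricci_flow br J om0 g0 (a b : \bar R)
    (om g : R -> V -> V -> R) : Prop :=
  [/\ forall X Y, om 0 X Y = om0 X Y,
      forall X Y, g 0 X Y = g0 X Y &
      forall t, (a < t%:E < b)%E ->
        hermitian_structure br J (om t) (g t) /\
        forall X Y, is_derive t 1 (fun s => om s X Y)
                      (- 2 * chern_ricci_form br J X Y)].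

(* Derivative of a curve in [V], taken on its row of coordinates in a basis. *)
Definition is_derive_vect (f : R -> V) (t : R) (v : V) : Prop :=
  is_derive t 1 (fun s => rVof (vbasis {:V}%VS) (f s)) (rVof (vbasis {:V}%VS) v).

Definition delta br A (X Y : V) : V := br (A X) Y + br X (A Y) - A (br X Y).

Definition bracket_flow br0 J om0 (a b : \bar R)
    (mu : R -> V -> V -> V) : Prop :=
  (forall X Y, mu 0 X Y = br0 X Y) /\
  forall t, (a < t%:E < b)%E ->
    lie_bracket (mu t) /\
    exists2 P, chern_ricci_operator (mu t) J om0 P &
      forall X Y, is_derive_vect (fun s => mu s X Y) t (delta (mu t) P X Y).

(* [h] is the positive definite square root of the positive definite
   [g]-symmetric operator [A]. *)
Definition pos_sqrt g A h : Prop :=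
  [/\ (h \o h)%VF = A,
      forall X Y, g (h X) Y = g X (h Y) &
      forall X, X != 0 -> 0 < g (h X) X].

(* [h^-1%VF] is the two-sided inverse when [h] is invertible. *)
Definition gl_act h br (X Y : V) : V := h (br (h^-1%VF X) (h^-1%VF Y)).

End ChernRicci.

(* Main.v *)
Require Import Defs.
From HB Require Import structures.
From mathcomp Require Import all_boot all_order all_algebra.
From mathcomp Require Import all_classical all_reals all_analysis.
From mathcomp Require Import complex.
From mathcomp Require Import ring lra.

(* The Chern-Ricci form p depends on the hermitian structure only through J, so
   along the flow it stays constant: omega(t) is affine in t, and it is
   degenerate exactly when 1 / (2 t) is an eigenvalue of P0.  Integrability
   makes p a (1,1)-form, so P0 is g0-symmetric and commutes with J; its spectral
   projections pi_i (eigenvalues a_i) are polynomials in P0, obtained by Lagrange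
   interpolation, and h(t) = (I - 2 t P0)^(1/2) is the sum of the
   (1 - 2 t a_i)^(1/2) pi_i.  Hence h(t).[X, Y] is an explicit sum with scalar
   coefficients in t, P_mu(t) = P0 (I - 2 t P0)^-1, and the bracket flow equation
   is checked coefficientwise.

   The bracket flow is an ordinary differential equation whose right-hand side is
   cubic in the structure constants, hence locally Lipschitz, and uniqueness is
   Gronwall's inequality.  No solution passes T+ or T-: P_mu has there an
   eigenvalue p / (1 - 2 t p) that blows up, whereas it is quadratic in mu. *)

Import Order.TTheory GRing.Theory Num.Theory.
Import numFieldNormedType.Exports.
Import passmx.

Set Implicit Arguments.
Unset Strict Implicit.
Unset Printing Implicit Defensive.

Local Open Scope ring_scope.

(** * Linear algebra and the spectral resolution *)

Section BilinearFor.
Variables (R : nzRingType) (U U' : lmodType R) (W : zmodType).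
Variables (s s' : GRing.Scale.law R W) (b : U -> U' -> W).
Hypothesis hb : bilinear_for s s' b.

Let bl (v : U') : {linear U -> W | s} :=
  HB.pack (b^~ v) (GRing.isLinear.Build R U W s (b^~ v) (hb.1 v)).
Let br (u : U) : {linear U' -> W | s'} :=
  HB.pack (b u) (GRing.isLinear.Build R U' W s' (b u) (hb.2 u)).

Lemma bilDl u1 u2 v : b (u1 + u2) v = b u1 v + b u2 v.
Proof. exact: (linearD (bl v)). Qed.
Lemma bilDr u v1 v2 : b u (v1 + v2) = b u v1 + b u v2.
Proof. exact: (linearD (br u)). Qed.
Lemma bilNl u v : b (- u) v = - b u v.
Proof. exact: (linearN (bl v)). Qed.
Lemma bilNr u v : b u (- v) = - b u v.
Proof. exact: (linearN (br u)). Qed.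
Lemma bilBl u1 u2 v : b (u1 - u2) v = b u1 v - b u2 v.
Proof. exact: (linearB (bl v)). Qed.

Lemma bil0l v : b 0 v = 0.
Proof. exact: (linear0 (bl v)). Qed.
Lemma bil0r u : b u 0 = 0.
Proof. exact: (linear0 (br u)). Qed.
Lemma bilZl a u v : b (a *: u) v = (s : R -> W -> W) a (b u v).
Proof. exact: (linearZ_LR (bl v)). Qed.
Lemma bilZr a u v : b u (a *: v) = (s' : R -> W -> W) a (b u v).
Proof. exact: (linearZ_LR (br u)). Qed.
Lemma bil_suml I r (P : pred I) F v :
  b (\sum_(i <- r | P i) F i) v = \sum_(i <- r | P i) b (F i) v.
Proof. exact: (linear_sum (bl v)). Qed.
Lemma bil_sumr I r (P : pred I) u F :
  b u (\sum_(i <- r | P i) F i) = \sum_(i <- r | P i) b u (F i).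
Proof. exact: (linear_sum (br u)). Qed.

End BilinearFor.

Lemma linfunE (K : nzRingType) (V W : vectType K) (f : V -> W) :
  linear f -> linfun f =1 f.
Proof.
move=> hf; pose ff : {linear V -> W} :=
  HB.pack f (GRing.isLinear.Build K V W *:%R f hf).
exact: (lfunE ff).
Qed.

(** * Polynomials in an endomorphism *)

Section LfunHorner.
Variables (K : fieldType) (V : vectType K) (P : 'End(V)).
Implicit Types (p q : {poly K}) (v : V).

(** Evaluation of [q] at [P], with composition as the product. Powers are iterates of composition,
    so the zero space needs no separate treatment. *)
Definition lfun_horner q : 'End(V) :=
  \sum_(i < size q) q`_i *: iter i (comp_lfun P) \1%VF.

Lemma lfun_horner_wide n q : (size q <= n)%N ->
  lfun_horner q = \sum_(i < n) q`_i *: iter i (comp_lfun P) \1%VF.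
Proof.
move=> le_qn; rewrite /lfun_horner (big_ord_widen n (fun i =>
  q`_i *: iter i (comp_lfun P) \1%VF)) //.
rewrite big_mkcond /=; apply: eq_bigr => i _.
by case: ltnP => // le; rewrite nth_default // scale0r.
Qed.

Lemma lfun_horner_is_linear : linear lfun_horner.
Proof.
move=> a p q; pose n := maxn (size p) (size q).
have le1 : (size (a *: p + q)%R <= n)%N.
  rewrite (leq_trans (size_polyD _ _)) // geq_max leq_maxr andbT.
  by rewrite (leq_trans (size_scale_leq _ _)) // leq_maxl.
rewrite (lfun_horner_wide le1) (@lfun_horner_wide n p) ?leq_maxl //.
rewrite (@lfun_horner_wide n q) ?leq_maxr // scaler_sumr -big_split /=.
by apply: eq_bigr => i _; rewrite coefD coefZ scalerDl scalerA.
Qed.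
HB.instance Definition _ :=
  GRing.isLinear.Build K {poly K} 'End(V) *:%R lfun_horner lfun_horner_is_linear.

Lemma lfun_hornerC c : lfun_horner c%:P = c *: \1%VF.
Proof.
rewrite (@lfun_horner_wide 1) ?size_polyC_leq1 // big_ord1 coefC eqxx /=.
by [].
Qed.

Lemma lfun_horner1 : lfun_horner 1 = \1%VF.
Proof. by rewrite lfun_hornerC scale1r. Qed.

Lemma lfun_hornerMX q : lfun_horner (q * 'X) = (P \o lfun_horner q)%VF.
Proof.
rewrite (@lfun_horner_wide (size q).+1); last first.
  by rewrite (leq_trans (size_polyMleq _ _)) // size_polyX addn2.
rewrite big_ord_recl coefMX eqxx scale0r add0r; apply/lfunP => v.
rewrite comp_lfunE !sum_lfunE linear_sum /=; apply: eq_bigr => i _.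
by rewrite !scale_lfunE coefMX /= linearZ /= comp_lfunE.
Qed.

Lemma lfun_hornerX : lfun_horner 'X = P.
Proof.
by rewrite -['X]mul1r lfun_hornerMX lfun_horner1 comp_lfun1r.
Qed.

Lemma lfun_hornerM p q :
  lfun_horner (p * q) = (lfun_horner p \o lfun_horner q)%VF.
Proof.
elim/poly_ind: p => [|p c IH]; first by rewrite mul0r linear0 comp_lfun0l.
rewrite mulrDl linearD /= mulrAC lfun_hornerMX IH mul_polyC linearZ /=.
rewrite [X in _ = (X \o _)%VF]linearD /= lfun_hornerMX lfun_hornerC.
by rewrite comp_lfunDl comp_lfunA -comp_lfunZl comp_lfun1l.
Qed.

Lemma lfun_hornerME p q v :
  lfun_horner (p * q) v = lfun_horner p (lfun_horner q v).
Proof. by rewrite lfun_hornerM comp_lfunE. Qed.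

Lemma lfun_horner_XsubC a v : lfun_horner ('X - a%:P) v = P v - a *: v.
Proof.
by rewrite linearB /= lfun_hornerX lfun_hornerC add_lfunE opp_lfunE
  scale_lfunE id_lfunE.
Qed.

Lemma lfun_horner_comm (A : 'End(V)) q : (forall v, A (P v) = P (A v)) ->
  forall v, A (lfun_horner q v) = lfun_horner q (A v).
Proof.
move=> cAP; elim/poly_ind: q => [|q c IH] v.
  by rewrite linear0 !zero_lfunE linear0.
rewrite linearD /= lfun_hornerMX lfun_hornerC !add_lfunE !comp_lfunE.
by rewrite !scale_lfunE !id_lfunE linearD linearZ /= cAP IH.
Qed.

(** The powers of [P] with exponents from 0 to the dimension of ['End(V)] are one too many to be
    independent; a nontrivial dependency gives the coefficients of [q]. *)
Lemma lfun_horner_annihilator : exists2 q, q != 0 & lfun_horner q = 0.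
Proof.
pose N := (\dim {: 'End(V)}).+1.
pose X := [tuple iter (i : 'I_N) (comp_lfun P) \1%VF | i < N].
have : ~~ free X.
  apply/negP => /eqP; rewrite size_tuple => dX.
  by have := dimvS (subvf <<X>>%VS); rewrite dX ltnn.
move/freeP => nfX.
have [k k0 [i ki]] : exists2 k : 'I_N -> K, \sum_(i < N) k i *: X`_i = 0 &
  exists i, k i != 0.
  apply: contrapT => H; apply: nfX => k k0 i.
  by apply/eqP; apply: contrapT => /negP ki; apply: H; exists k => //; exists i.
exists (\poly_(j < N) k (inord j)).
  apply/eqP => /(congr1 (fun p : {poly K} => p`_i)).
  by rewrite coef_poly ltn_ord inord_val coef0 => /eqP; rewrite (negPf ki).
rewrite (@lfun_horner_wide N) ?size_poly // -[RHS]k0; apply: eq_bigr => j _.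
by rewrite coef_poly ltn_ord inord_val -tnth_nth tnth_mktuple.
Qed.

End LfunHorner.

(** Take a root in the algebraic closure [F[i]]. A real one gives the first case. For a root a + ib
    with b nonzero, the remainder of [q] modulo the quadratic has degree at most 1 and real
    coefficients, and vanishes at a non-real number, so it is 0. *)
Lemma rcf_poly_factor (F : rcfType) (q : {poly F}) : (1 < size q)%N ->
  (exists a, root q a) \/
  exists a b, b != 0 /\ (('X - a%:P) ^+ 2 + (b ^+ 2)%:P) %| q.
Proof.
move=> sq; pose qC : {poly F[i]} := map_poly (real_complex F) q.
have /closed_rootP [[a b] rz] : size qC != 1%N.
  by rewrite size_map_poly; case: ltngtP sq.
have [b0|b0] := eqVneq b 0.
  by left; exists a; move: rz;
    rewrite b0 /qC -[(a +i* 0)%C]/(real_complex F a) fmorph_root.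
right; exists a, b; split=> //.
set d := _ + _.
have sd : size d = 3%N.
  rewrite /d size_polyDl ?size_exp_XsubC //.
  by rewrite (leq_ltn_trans (size_polyC_leq1 _)).
have d0 : d != 0 by rewrite -size_poly_gt0 sd.
have rd : root (map_poly (real_complex F) d) (a +i* b)%C.
  rewrite /root /d rmorphD rmorphXn /= rmorphB /= map_polyX !map_polyC /=.
  rewrite !hornerE; apply/eqP; simpc.
  by apply/eqP; rewrite eq_complex /= ; apply/andP; split; apply/eqP; ring.
rewrite /dvdp; set r := q %% d.
have sr : (size r <= 2)%N by rewrite -ltnS -sd ltn_modp.
have rr : root (map_poly (real_complex F) r) (a +i* b)%C.
  have := rz; rewrite /qC (divp_eq q d) rmorphD rmorphM /= /root hornerD hornerM.
  by rewrite (eqP rd) mulr0 add0r.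
have Er : r = (r`_0)%:P + r`_1 *: 'X.
  apply/polyP => i; rewrite coefD coefC coefZ coefX.
  case: i => [|[|i]] /=; rewrite ?mulr0 ?addr0 ?mulr1 ?add0r //.
  by rewrite nth_default // (leq_trans sr).
move: rr; rewrite Er rmorphD /= map_polyC map_polyZ map_polyX /= /root !hornerE.
move=> /eqP; simpc; move=> /eqP; rewrite eq_complex /= => /andP[].
rewrite ?add0r ?mul0r ?subr0 ?addr0 mulf_eq0 (negPf b0) orbF => h0 /eqP h1.
by move: h0; rewrite h1 mul0r addr0 => /eqP ->; rewrite scale0r addr0.
Qed.

(** * Lagrange interpolation *)

Section Lagrange.
Variables (F : fieldType).
Implicit Types (s : seq F) (x y : F).

Definition lagrange_basis s x : {poly F} :=
  (\prod_(b <- s | b != x) (x - b))^-1 *: \prod_(b <- s | b != x) ('X - b%:P).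

Lemma lagrange_basisE s x y : x \in s -> y \in s ->
  (lagrange_basis s x).[y] = (y == x)%:R.
Proof.
move=> xs ys; rewrite /lagrange_basis hornerZ horner_prod.
have [->|yx] := eqVneq y x.
  under [X in _ * X]eq_bigr do rewrite hornerXsubC.
  rewrite mulVf // prodf_seq_neq0; apply/allP => b _.
  by apply/implyP; rewrite subr_eq0 eq_sym.
rewrite [X in _ * X](big_rem y) //= yx hornerXsubC subrr mul0r mulr0.
by [].
Qed.

(** When the product over [s] annihilates [P], this makes the image of the interpolation polynomial
    at [P] consist of vectors on which [P] acts as the scalar [x]. *)
Lemma lagrange_basis_mul s x : uniq s -> x \in s ->
  exists c, ('X - x%:P) * lagrange_basis s x = c *: \prod_(b <- s) ('X - b%:P).
Proof.
move=> us xs; eexists; rewrite /lagrange_basis -scalerAr; congr (_ *: _).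
rewrite [RHS](big_rem x) //=; congr (_ * _).
by rewrite rem_filter // big_filter.
Qed.

(** The difference of the two sides vanishes at every point of [s], while its degree is less than
    the number of points. *)
Lemma sum_lagrange_basis s : s != [::] -> uniq s ->
  \sum_(x <- s) lagrange_basis s x = 1.
Proof.
move=> s0 us; apply/eqP; rewrite -subr_eq0; apply/eqP.
apply: (@roots_geq_poly_eq0 _ _ s) => //.
  apply/allP => y ys; rewrite /root hornerD hornerN hornerC horner_sum.
  rewrite (bigD1_seq y) //= lagrange_basisE // eqxx big_seq_cond big1 ?addr0
    ?subrr //.
  by move=> x /andP[xs xy]; rewrite lagrange_basisE // eq_sym (negPf xy).
rewrite (leq_trans (size_polyD _ _)) // geq_max size_polyN size_poly1.
rewrite lt0n size_eq0 s0 andbT.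
rewrite big_seq; apply: (big_ind (fun p : {poly F} =>
  (size p <= size s)%N)) => [|p q hp hq|x xs].
- by rewrite size_poly0.
- by rewrite (leq_trans (size_polyD _ _)) // geq_max hp.
rewrite (leq_trans (size_scale_leq _ _)) // -big_filter size_prod_XsubC.
rewrite size_filter -(count_predC (pred1 x) s) -add1n leq_add2r.
by rewrite -has_count has_pred1.
Qed.

End Lagrange.

(** Asking each projection to be nonzero makes every [a i] an eigenvalue. Symmetry of the
    projections concerns the metric and is stated separately. *)
Definition spectral_resolution (R : realType) (V : vectType R) (P : 'End(V))
    m (a : 'I_m -> R) (pi : 'I_m -> 'End(V)) : Prop :=
  [/\ forall i, pi i != 0,
      forall i j v, pi i (pi j v) = (i == j)%:R *: pi j v,
      forall v, \sum_i pi i v = v &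
      forall i v, P (pi i v) = a i *: pi i v].

(** * The spectral theorem for symmetric operators *)

Section SymmetricOperator.
Variables (R : realType) (V : vectType R) (g : V -> V -> R) (P : 'End(V)).
Hypothesis g_ip : inner_product g.
Hypothesis P_sym : forall X Y, g (P X) Y = g X (P Y).

Let gb : bilinear_for *%R *%R g. Proof. by case: g_ip. Qed.
Let gC X Y : g X Y = g Y X. Proof. by case: g_ip. Qed.
Let gpos X : X != 0 -> 0 < g X X. Proof. by case: g_ip => _ _; apply. Qed.

Lemma inner_product_ge0 X : 0 <= g X X.
Proof. by have [->|/gpos/ltW//] := eqVneq X 0; rewrite (bil0l gb). Qed.

Lemma inner_product_eq0 X : g X X = 0 -> X = 0.
Proof. by move=> gX; apply/eqP; apply: contraT => /gpos; rewrite gX ltxx. Qed.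

Lemma symmetric_horner_sym q X Y :
  g (lfun_horner P q X) Y = g X (lfun_horner P q Y).
Proof.
elim/poly_ind: q X Y => [|q c IH] X Y.
  by rewrite linear0 !zero_lfunE (bil0l gb) (bil0r gb).
rewrite linearD /= lfun_hornerMX lfun_hornerC !add_lfunE !comp_lfunE.
rewrite !scale_lfunE !id_lfunE (bilDl gb) (bilDr gb) (bilZl gb) (bilZr gb) /=.
rewrite P_sym IH; congr (_ + _); congr (g X _).
exact/esym/lfun_horner_comm.
Qed.

(** With N = P - a, symmetry gives g(Nv, Nv) = g(v, N N v) = 0. *)
Lemma symmetric_sqr_kernel a v :
  lfun_horner P (('X - a%:P) ^+ 2) v = 0 -> lfun_horner P ('X - a%:P) v = 0.
Proof.
move=> h; apply: inner_product_eq0.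
by rewrite symmetric_horner_sym -lfun_hornerME -expr2 h (bil0r gb).
Qed.

(** Pairing the equation with [v] gives |(P - a)v|^2 + b^2 |v|^2 = 0, a sum of two nonnegative
    terms. *)
Lemma symmetric_no_complex_root a b v : b != 0 ->
  lfun_horner P (('X - a%:P) ^+ 2 + (b ^+ 2)%:P) v = 0 -> v = 0.
Proof.
move=> b0; rewrite linearD /= add_lfunE lfun_hornerC scale_lfunE id_lfunE.
move=> /(congr1 (g v)); rewrite (bilDr gb) (bilZr gb) (bil0r gb) /=.
rewrite expr2 lfun_hornerME -symmetric_horner_sym => h.
apply: inner_product_eq0; move: h.
move: (inner_product_ge0 v) (inner_product_ge0 (lfun_horner P ('X - a%:P) v)).
have : 0 < b ^+ 2 by rewrite exprn_even_gt0.
move: (g _ _) (g _ _) (b ^+ 2) => x y z z0 y0 x0 h.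
apply: (mulfI (lt0r_neq0 z0)); rewrite mulr0; apply/eqP.
have zx := mulr_ge0 (ltW z0) y0.
by rewrite eq_le zx andbT; lra.
Qed.

Lemma symmetric_horner_sqr0 a p :
  lfun_horner P (('X - a%:P) ^+ 2 * p) = 0 ->
  lfun_horner P (('X - a%:P) * p) = 0.
Proof.
move=> /lfunP h; apply/lfunP => v; rewrite zero_lfunE lfun_hornerME.
by apply: symmetric_sqr_kernel; rewrite -lfun_hornerME h zero_lfunE.
Qed.

(** Repeated roots are dropped one at a time. The cofactor [p] is arbitrary so that the induction
    can move the factors already treated into it. *)
Lemma symmetric_horner_undup0 s p :
  lfun_horner P (\prod_(a <- s) ('X - a%:P) * p) = 0 ->
  lfun_horner P (\prod_(a <- undup s) ('X - a%:P) * p) = 0.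
Proof.
elim: s p => [|a s IH] //= p; rewrite big_cons -mulrA mulrCA => /IH {}IH.
case: ifP => [as_|_]; last by rewrite big_cons -mulrA mulrCA.
move: IH; rewrite (big_rem a) ?mem_undup //= -mulrA => IH.
by rewrite -mulrA; apply: symmetric_horner_sqr0;
  rewrite expr2 -mulrA [X in _ * X]mulrCA.
Qed.

(** Induction on the degree of [q], the part of the annihilator not yet split: a linear factor is
    moved to the list, and a quadratic factor without real roots is injective at [P], hence can be
    cancelled. Once [q] is a nonzero constant the list alone annihilates [P], and its repetitions
    are then removed. *)
Lemma symmetric_annihilator_split :
  exists2 s : seq R, uniq s & lfun_horner P (\prod_(a <- s) ('X - a%:P)) = 0.
Proof.
have [q q0 Eq] := lfun_horner_annihilator P.
suff [s Es] : exists s : seq R, lfun_horner P (\prod_(a <- s) ('X - a%:P)) = 0.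
  exists (undup s); first exact: undup_uniq.
  by rewrite -[X in lfun_horner P X]mulr1; apply: symmetric_horner_undup0;
    rewrite mulr1.
have : lfun_horner P (q * \prod_(a <- [::]) ('X - a%:P)) = 0 by rewrite
  big_nil mulr1.
have [n] := ubnP (size q); elim: n q q0 [::] {Eq} => // n IHn q q0 s sq Eq.
have [sq1|sq1] := leqP (size q) 1.
  exists s; move: q0 Eq; rewrite [q]size1_polyC // polyC_eq0 => c0.
  rewrite mul_polyC linearZ /= => /eqP; rewrite scaler_eq0 (negPf c0) /=.
  by move/eqP.
have [[a /factor_theorem [r qE]]|[a [b [b0 /dvdpP [r qE]]]]] :=
  rcf_poly_factor sq1.
  have r0 : r != 0 by apply: contraNneq q0 => r0; rewrite qE r0 mul0r.
  apply: (IHn r r0 (a :: s)).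
    by rewrite -ltnS (leq_trans _ sq) // qE size_Mmonic ?monicXsubC //
      size_XsubC addn2.
  by rewrite big_cons mulrA -qE.
have r0 : r != 0 by apply: contraNneq q0 => r0; rewrite qE r0 mul0r.
set d := _ + _ in qE.
have sd : size d = 3%N.
  rewrite /d size_polyDl ?size_exp_XsubC //.
  by rewrite (leq_ltn_trans (size_polyC_leq1 _)).
have d0 : d != 0 by rewrite -size_poly_gt0 sd.
apply: (IHn r r0 s).
  by rewrite -ltnS (leq_trans _ sq) // qE size_mul // sd addnS addn2.
apply/lfunP => v; rewrite zero_lfunE.
apply: (@symmetric_no_complex_root a b) => //; rewrite -/d.
by rewrite -lfun_hornerME mulrA [d * r]mulrC -qE Eq zero_lfunE.
Qed.

Lemma symmetric_spectral_resolution :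
  exists m (a : 'I_m -> R) (pi : 'I_m -> 'End(V)),
  [/\ spectral_resolution P a pi,
      forall i X Y, g (pi i X) Y = g X (pi i Y) &
      forall A : 'End(V), (forall v, A (P v) = P (A v)) ->
        forall i v, A (pi i v) = pi i (A v)].
Proof.
have [s us Es] := symmetric_annihilator_split.
pose L x := lfun_horner P (lagrange_basis s x).
(* A root of the annihilator need not be an eigenvalue; only the points with a nonzero projection
   are kept. *)
pose s' := [seq x <- s | L x != 0].
have us' : uniq s' by rewrite filter_uniq.
have s's (i : 'I_(size s')) : tnth (in_tuple s') i \in s.
  by have := mem_tnth i (in_tuple s'); rewrite mem_filter => /andP[].
have PL x v : x \in s -> P (L x v) = x *: L x v.
  move=> xs; apply/eqP; rewrite -subr_eq0; apply/eqP.
  rewrite -lfun_horner_XsubC -lfun_hornerME.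
  have [c ->] := lagrange_basis_mul us xs.
  by rewrite linearZ /= Es scaler0 zero_lfunE.
(* On the image of [L x] the operator [P] is the scalar [x], so [q] of [P] is the scalar [q.[x]].
   For [q] an interpolation polynomial this yields the products of the projections. *)
have EL q x v : x \in s -> lfun_horner P q (L x v) = q.[x] *: L x v.
  move=> xs; elim/poly_ind: q => [|q c IH].
    by rewrite linear0 zero_lfunE horner0 scale0r.
  rewrite linearD /= lfun_hornerMX lfun_hornerC add_lfunE comp_lfunE IH.
  by rewrite scale_lfunE id_lfunE linearZ /= PL // scalerA !hornerE scalerDl.
exists (size s'), (fun i => tnth (in_tuple s') i), (fun i =>
  L (tnth (in_tuple s') i)).
split; [split|..].
- by move=> i; have := mem_tnth i (in_tuple s'); rewrite mem_filter => /andP[].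
- move=> i j v; rewrite EL // lagrange_basisE //; congr (_%:R *: _).
  congr nat_of_bool; rewrite eq_sym; apply/eqP/eqP => [|->//].
  move/eqP; rewrite !(tnth_nth 0) /= nth_uniq ?ltn_ord //.
  by move/eqP/val_inj.
- move=> v; rewrite -(big_tnth _ _ s' predT (fun x => L x v)) big_filter.
  rewrite big_mkcond /= (eq_bigr (fun x => L x v)); last first.
    by move=> x _; case: eqP => // ->; rewrite zero_lfunE.
  (* An empty list means that the constant 1 annihilates [P], so that [V] is zero. *)
  have [s0|s0] := eqVneq s [::].
    move: Es; rewrite s0 !big_nil lfun_horner1 => /lfunP/(_ v).
    by rewrite id_lfunE zero_lfunE => ->.
  by rewrite -sum_lfunE -linear_sum /= sum_lagrange_basis // lfun_horner1
    id_lfunE.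
- by move=> i v; apply: PL.
- by move=> i X Y; apply: symmetric_horner_sym.
by move=> A hA i v; apply: lfun_horner_comm.
Qed.
End SymmetricOperator.

(** * Algebra of the Chern-Ricci form *)

Section Lftrace.
Variables (R : realType) (V : vectType R).
Implicit Types A B : 'End(V).
Local Notation e := (vbasis {:V}%VS).

Lemma lftraceE A : lftrace A = \sum_i coord e i (A e`_i).
Proof. by apply: eq_bigr => i _; rewrite mxE /= vecof_delta mxE. Qed.

Lemma lftrace_linear : linear_for *%R (@lftrace R V).
Proof. by move=> a A B; rewrite /lftrace !linearP. Qed.
HB.instance Definition _ :=
  GRing.isLinear.Build R 'End(V) R *%R (@lftrace R V) lftrace_linear.

Lemma lftrace_compC A B : lftrace (A \o B)%VF = lftrace (B \o A)%VF.
Proof.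
by rewrite /lftrace !(mxof_comp _ _ (vbasisP _)) mxtrace_mulC.
Qed.

(* The trace of J [a, b] only sees the parts of a and b that anticommute with
  J. *)
Lemma lftrace_comm_complex (J a b : 'End(V)) : (forall X, J (J X) = - X) ->
  2 * lftrace (J \o ((a \o b) - (b \o a)))%VF =
  - lftrace (((a \o J) - (J \o a)) \o (J \o ((b \o J) - (J \o b))))%VF.
Proof.
move=> JJ.
have -> : (((a \o J) - (J \o a)) \o (J \o ((b \o J) - (J \o b))))%VF =
   (- ((a \o b) \o J) + ((a \o J) \o b) - (J \o (((a \o J) \o b) \o J)) - (J
     \o (a \o b)))%VF.
  apply/lfunP => X; rewrite !(add_lfunE, comp_lfunE, opp_lfunE) !linearB /= !JJ.
  rewrite !(linearN a) !(linearN J) /= !opprK.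
  by rewrite -!addrA.
have -> : (J \o ((a \o b) - (b \o a)) = (J \o (a \o b)) - (J \o (b \o a)))%VF.
  by apply/lfunP => X; rewrite !(add_lfunE, comp_lfunE, opp_lfunE) linearB.
have E1 : lftrace ((a \o b) \o J)%VF = lftrace (J \o (a \o b))%VF.
  exact: lftrace_compC.
have E2 : lftrace ((a \o J) \o b)%VF = lftrace (J \o (b \o a))%VF.
  by rewrite -comp_lfunA lftrace_compC comp_lfunA.
have E3 : lftrace (J \o (((a \o J) \o b) \o J))%VF = - lftrace (J \o (b \o a))%VF.
  rewrite lftrace_compC -E2 -(linearN (@lftrace R V)); congr lftrace;
    apply/lfunP => X.
  by rewrite !(opp_lfunE, comp_lfunE) JJ (linearN b) (linearN J) (linearN a).
rewrite !(linearB (@lftrace R V)) (linearD (@lftrace R V)) (linearN (@lftrace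
  R V)) /= E1 E2 E3; ring.
Qed.
End Lftrace.

(** * The Chern-Ricci form is of type (1,1) *)

Section ChernRicciForm.
Variables (R : realType) (V : vectType R) (br : V -> V -> V) (J : 'End(V)).
Hypothesis br_lie : lie_bracket br.
Hypothesis JJ : forall X, J (J X) = - X.

Let bb : bilinear_for *:%R *:%R br. Proof. by case: br_lie. Qed.

Lemma lie_bracketC X Y : br X Y = - br Y X.
Proof.
have [_ brr _] := br_lie; apply/eqP; rewrite -addr_eq0 -(brr (X + Y)).
by rewrite (bilDl bb) !(bilDr bb) !brr addr0 add0r.
Qed.

Lemma adE X Y : ad br X Y = br X Y.
Proof. by rewrite linfunE //; exact: bb.2. Qed.

Lemma ad_linear : linear (ad br).
Proof.
move=> a X Y; apply/lfunP => Z.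
by rewrite add_lfunE scale_lfunE !adE (bilDl bb) (bilZl bb).
Qed.

Lemma adN X : ad br (- X) = - ad br X.
Proof. by rewrite -[- X]addr0 -scaleN1r ad_linear scaleN1r (_ : ad br 0 = 0)
  ?addr0 //;
  apply/lfunP => Y; rewrite adE zero_lfunE (bil0l bb). Qed.

Lemma adD X Y : ad br (X + Y) = ad br X + ad br Y.
Proof. by rewrite -[X in X + _]scale1r ad_linear scale1r. Qed.

Lemma ad_bracket X Y :
  ad br (br X Y) = ((ad br X \o ad br Y) - (ad br Y \o ad br X))%VF.
Proof.
have [_ _ jac] := br_lie.
apply/lfunP => Z; rewrite add_lfunE opp_lfunE !comp_lfunE !adE.
have /eqP := jac X Y Z; rewrite addr_eq0 => /eqP H.
by rewrite lie_bracketC -H (lie_bracketC Z X) (bilNr bb).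
Qed.

Lemma lftrace_ad_bracket X Y : lftrace (ad br (br X Y)) = 0.
Proof. by rewrite ad_bracket linearB /= lftrace_compC subrr. Qed.

Hypothesis J_int : integrable_complex br J.

Lemma integrable_bracketJ X Y :
  br (J X) (J Y) = br X Y + J (br (J X) Y + br X (J Y)).
Proof.
have /eqP := J_int X Y; rewrite linearD /= -!addrA -!opprD subr_eq0 => /eqP ->.
by [].
Qed.

(** Integrability restated: the commutator of [ad br X] with [J], which measures the part
    anticommuting with [J], is complex linear in [X]. *)
Lemma ad_comm_complex X :
  ((ad br (J X) \o J) - (J \o ad br (J X)) =
   J \o ((ad br X \o J) - (J \o ad br X)))%VF.
Proof.
apply/lfunP => Z; rewrite !(add_lfunE, opp_lfunE, comp_lfunE) !adE.
rewrite integrable_bracketJ !linearD linearN /= JJ opprK.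
by rewrite [J _ + _]addrC addrA addrK addrC.
Qed.

(** Write D_X for the commutator of [ad br X] with [J]. The trace depends only on D_X J D_Y. Since
    D_{JX} = J D_X and D_X anticommutes with [J], replacing X, Y by JX, JY gives J D_X J J D_Y = - J
    D_X D_Y = D_X J D_Y. *)
Lemma lftrace_J_ad_bracketJ X Y :
  lftrace (J \o ad br (br (J X) (J Y)))%VF = lftrace (J \o ad br (br X Y))%VF.
Proof.
apply: (mulfI (_ : 2 != 0)); first by rewrite pnatr_eq0.
pose D (a : 'End(V)) := ((a \o J) - (J \o a))%VF.
have anti a W : D a (J W) = - J (D a W).
  rewrite /D !(add_lfunE, opp_lfunE, comp_lfunE) (linearB J) /= !JJ (linearN a).
  by rewrite opprK opprD addrC.
have trE a b : 2 * lftrace (J \o ((a \o b) - (b \o a)))%VF =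
    - lftrace (D a \o (J \o D b))%VF := lftrace_comm_complex a b JJ.
have DJ Z : D (ad br (J Z)) = (J \o D (ad br Z))%VF := ad_comm_complex Z.
rewrite !ad_bracket !trE !DJ; congr (- lftrace _); apply/lfunP => Z.
by rewrite !comp_lfunE JJ (linearN (D _)) (linearN J) anti.
Qed.

(** For the second trace, integrability gives J[JX, JY] = J[X, Y] - Z with Z = [JX, Y] + [X, JY],
    and the adjoint map of a sum of brackets has trace 0. *)
Lemma chern_ricci_formJ X Y :
  chern_ricci_form br J (J X) (J Y) = chern_ricci_form br J X Y.
Proof.
rewrite /chern_ricci_form lftrace_J_ad_bracketJ; congr (_ + _ * _).
rewrite integrable_bracketJ linearD /= JJ adD adN adD linearD.
by rewrite (linearN (@lftrace R V)) linearD /= !lftrace_ad_bracket addr0 oppr0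
  addr0.
Qed.

Lemma chern_ricci_formC X Y :
  chern_ricci_form br J X Y = - chern_ricci_form br J Y X.
Proof.
rewrite /chern_ricci_form lie_bracketC (linearN J) /= !adN.
have -> : (J \o - ad br (br Y X) = - (J \o ad br (br Y X)))%VF.
  by apply/lfunP => Z; rewrite !(opp_lfunE, comp_lfunE) linearN.
by rewrite !(linearN (@lftrace R V)) /=; ring.
Qed.

End ChernRicciForm.

(** * Transport of a bracket by an invertible operator *)

Section GlAction.
Variables (R : realType) (V : vectType R) (br : V -> V -> V) (J h k : 'End(V)).
Hypothesis hk : forall X, h (k X) = X.
Hypothesis kh : forall X, k (h X) = X.

Lemma inv_lfun_uniq : (h^-1)%VF = k.
Proof.
have kerh : lker h == 0%VS by apply/lker0P; apply: can_inj kh.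
by apply/lfunP => X; rewrite -{1}[X]hk lker0_lfunK.
Qed.

Lemma gl_actE X Y : gl_act h br X Y = h (br (k X) (k Y)).
Proof. by rewrite /gl_act inv_lfun_uniq. Qed.

Hypothesis br_lie : lie_bracket br.
Let bb : bilinear_for *:%R *:%R br. Proof. by case: br_lie. Qed.

Lemma gl_act_lie_bracket : lie_bracket (gl_act h br).
Proof.
have [_ brr jac] := br_lie; split.
- split=> [Y a X Z|X a Y Z]; rewrite !gl_actE linearP.
    by rewrite (bilDl bb) (bilZl bb) linearP.
  by rewrite (bilDr bb) (bilZr bb) linearP.
- by move=> X; rewrite gl_actE brr linear0.
- by move=> X Y Z; rewrite !gl_actE !kh -!linearD /= jac linear0.
Qed.

Hypothesis hJ : forall X, h (J X) = J (h X).

Let kJ X : k (J X) = J (k X).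
Proof. by rewrite -{1}[X]hk -hJ kh. Qed.

Lemma gl_act_integrable : integrable_complex br J ->
  integrable_complex (gl_act h br) J.
Proof.
move=> J_int X Y; rewrite !gl_actE !kJ -!hJ -!linearB /=.
by rewrite J_int linear0.
Qed.

Lemma gl_act_ad X : ad (gl_act h br) X = (h \o (ad br (k X) \o k))%VF.
Proof.
apply/lfunP => Y; rewrite (adE gl_act_lie_bracket) gl_actE !comp_lfunE.
by rewrite adE.
Qed.

(** [h] is a Lie algebra isomorphism from [br] to [gl_act h br] that commutes with [J], and traces
    are invariant under conjugation. *)
Lemma gl_act_chern_ricci_form X Y :
  chern_ricci_form (gl_act h br) J X Y = chern_ricci_form br J (k X) (k Y).
Proof.
rewrite /chern_ricci_form !gl_act_ad !gl_actE -hJ !kh.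
congr (- (_ * _) + _ * _).
  have -> (A : 'End(V)) : (J \o (h \o (A \o k)) = h \o ((J \o A) \o k))%VF.
    by apply/lfunP => Z; rewrite !comp_lfunE hJ.
  by rewrite lftrace_compC; congr lftrace; apply/lfunP => Z;
    rewrite !comp_lfunE kh.
by rewrite lftrace_compC; congr lftrace; apply/lfunP => Z; rewrite !comp_lfunE kh.
Qed.
End GlAction.

(** * Symmetry of the Chern-Ricci operator *)

Section HermitianStructure.
Variables (R : realType) (V : vectType R) (br : V -> V -> V) (J : 'End(V)).
Variables (om g : V -> V -> R).
Hypothesis herm : hermitian_structure br J om g.

Let ob : bilinear_for *%R *%R om. Proof. by case: herm => -[]. Qed.
Let gb : bilinear_for *%R *%R g. Proof. by case: herm => _ []. Qed.
Let gC X Y : g X Y = g Y X. Proof. by case: herm => _ []. Qed.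
Let omE X Y : om X Y = g (J X) Y. Proof. by case: herm. Qed.
Let JJ X : J (J X) = - X. Proof. by case: herm. Qed.

Lemma hermitian_omC X Y : om X Y = - om Y X.
Proof.
have [[_ omr _] _ _ _ _] := herm; apply/eqP; rewrite -addr_eq0 -(omr (X + Y)).
by rewrite (bilDl ob) !(bilDr ob) !omr addr0 add0r.
Qed.

Lemma hermitian_gE X Y : g X Y = om X (J Y).
Proof. by rewrite hermitian_omC omE JJ (bilNl gb) opprK gC. Qed.

Lemma hermitian_om_inj U W : (forall Y, om U Y = om W Y) -> U = W.
Proof.
have [[_ _ nd] _ _ _ _] := herm => h; apply/eqP; rewrite -subr_eq0; apply/eqP.
by apply: nd => Y; rewrite (bilBl ob) h subrr.
Qed.

Variable P : 'End(V).
Hypothesis br_lie : lie_bracket br.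
Hypothesis P_cr : chern_ricci_operator br J om P.

(** Both [om] and the Chern-Ricci form are invariant under [J], and non-degeneracy of [om] transfers
    this to [P]. *)
Lemma chern_ricci_operator_J X : P (J X) = J (P X).
Proof.
have [_ _ _ _ J_int] := herm.
apply: hermitian_om_inj => Y; rewrite [RHS]omE JJ (bilNl gb) hermitian_gE.
have EY : Y = J (- J Y) by rewrite (linearN J) /= JJ opprK.
by rewrite {1}EY -P_cr chern_ricci_formJ // P_cr (bilNr ob).
Qed.

(** Both sides equal p(X, JY): the left one directly, the right one by skew-symmetry of p and
    because [P] commutes with [J]. *)
Lemma chern_ricci_operator_sym X Y : g (P X) Y = g X (P Y).
Proof.
rewrite !hermitian_gE -chern_ricci_operator_J -P_cr chern_ricci_formC //.
by rewrite P_cr -hermitian_omC.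
Qed.

End HermitianStructure.

(** * Functional calculus and the endpoints of the existence interval *)

Section FunctionalCalculus.
Variables (R : realType) (V : vectType R) (P : 'End(V)).
Variables (m : nat) (a : 'I_m -> R) (pi : 'I_m -> 'End(V)).
Hypothesis P_res : spectral_resolution P a pi.
Implicit Types (f h : 'I_m -> R).

(** With [f i] the value at [a i] of a function F, this is F(P). *)
Definition fcalc f : 'End(V) := \sum_i f i *: pi i.

Lemma fcalcE f X : fcalc f X = \sum_i f i *: pi i X.
Proof. by rewrite sum_lfunE; apply: eq_bigr => i _; rewrite scale_lfunE. Qed.

Lemma eq_fcalc f h : f =1 h -> fcalc f = fcalc h.
Proof. by move=> fh; apply: eq_bigr => i _; rewrite fh. Qed.

Lemma proj_fcalc f i X : pi i (fcalc f X) = f i *: pi i X.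
Proof.
have [_ pp _ _] := P_res.
rewrite fcalcE linear_sum (bigD1 i) //= big1 ?addr0 => [|j ji].
  by rewrite linearZ /= pp eqxx scale1r.
by rewrite linearZ /= pp eq_sym (negPf ji) scale0r scaler0.
Qed.

Lemma fcalcM f h X : fcalc f (fcalc h X) = fcalc (fun i => f i * h i) X.
Proof.
by rewrite [LHS]fcalcE [RHS]fcalcE; apply: eq_bigr => i _;
  rewrite proj_fcalc scalerA.
Qed.

Lemma fcalc1 X : fcalc (fun=> 1) X = X.
Proof.
have [_ _ sp _] := P_res.
by rewrite fcalcE -[RHS]sp; apply: eq_bigr => i _; rewrite scale1r.
Qed.

Lemma fcalc_eigen X : fcalc a X = P X.
Proof.
have [_ _ sp pe] := P_res.
by rewrite fcalcE -[in RHS](sp X) linear_sum; apply: eq_bigr => i _;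
  rewrite /= pe.
Qed.

Lemma proj_op i X : pi i (P X) = a i *: pi i X.
Proof. by rewrite -fcalc_eigen proj_fcalc. Qed.

Lemma fcalc_comm (A : 'End(V)) f : (forall i X, A (pi i X) = pi i (A X)) ->
  forall X, A (fcalc f X) = fcalc f (A X).
Proof.
move=> hA X; rewrite !fcalcE linear_sum; apply: eq_bigr => i _.
by rewrite linearZ /= hA.
Qed.

Lemma resolution_eigenvalue i : exists2 X, X != 0 & P X = a i *: X.
Proof.
have [pn _ _ pe] := P_res.
have [X pX] : exists X, pi i X != 0.
  apply: contrapT => H; move: (pn i) => /eqP; apply; apply/lfunP => X.
  by rewrite zero_lfunE; apply/eqP; apply: contrapT => /negP ?; apply: H;
    exists X.
by exists (pi i X).
Qed.

Lemma leigenvalueP c : leigenvalue P c <-> exists2 X, X != 0 & P X = c *: X.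
Proof.
rewrite /leigenvalue /leigenspace; split=> [|[X X0 PX]].
  move=> k0; exists (vpick (lker (P - c *: \1%VF))); first by rewrite vpick0.
  have := memv_pick (lker (P - c *: \1%VF)); rewrite memv_ker.
  by rewrite add_lfunE opp_lfunE scale_lfunE id_lfunE subr_eq0 => /eqP.
apply/negP => /eqP k0; move/eqP: X0; apply; apply/eqP.
rewrite -memv0 -k0 memv_ker add_lfunE opp_lfunE scale_lfunE id_lfunE PX.
by rewrite subrr.
Qed.

(** An eigenvector has some nonzero component [pi i X], and applying [pi i] to the eigenvalue
    equation gives [(c - a i) *: pi i X = 0]. *)
Lemma leigenvalue_resolution c : leigenvalue P c <-> exists i, c = a i.
Proof.
rewrite leigenvalueP; split=> [[X X0 PX]|[i ->]];
  last exact: resolution_eigenvalue.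
have [_ _ sp _] := P_res; apply: contrapT => H; move/eqP: X0; apply.
rewrite -[LHS]sp big1 // => i _; apply/eqP; apply: contrapT => /negP piX.
apply: H; exists i; apply/eqP; rewrite -subr_eq0.
have : (c - a i) *: pi i X = 0 by rewrite scalerBl -proj_op PX linearZ subrr.
by move/eqP; rewrite scaler_eq0 (negPf piX) orbF.
Qed.

Variable g : V -> V -> R.
Hypothesis g_ip : inner_product g.
Hypothesis pi_sym : forall i X Y, g (pi i X) Y = g X (pi i Y).
Let gb : bilinear_for *%R *%R g. Proof. by case: g_ip. Qed.

Lemma fcalc_sym f X Y : g (fcalc f X) Y = g X (fcalc f Y).
Proof.
rewrite !fcalcE (bil_suml gb) (bil_sumr gb); apply: eq_bigr => i _.
by rewrite (bilZl gb) (bilZr gb) /= pi_sym.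
Qed.

Lemma fcalc_quadratic f X :
  g (fcalc f X) X = \sum_i f i * g (pi i X) (pi i X).
Proof.
have [_ pp _ _] := P_res.
rewrite fcalcE (bil_suml gb); apply: eq_bigr => i _.
by rewrite (bilZl gb) /= [in RHS]pi_sym pp eqxx scale1r pi_sym.
Qed.

Lemma fcalc_ge0 f X : (forall i, 0 <= f i) -> 0 <= g (fcalc f X) X.
Proof.
move=> f0; rewrite fcalc_quadratic sumr_ge0 // => i _.
by apply: mulr_ge0; [exact: f0 | exact: inner_product_ge0 g_ip _].
Qed.

Lemma fcalc_gt0 f X : (forall i, 0 < f i) -> X != 0 -> 0 < g (fcalc f X) X.
Proof.
move=> f0 X0; rewrite lt0r fcalc_ge0 ?andbT; last by move=> i; exact: ltW.
apply: contra_neq X0 => /eqP; rewrite fcalc_quadratic psumr_eq0; last first.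
  by move=> i _; apply: mulr_ge0;
    [exact/ltW/f0 | exact: inner_product_ge0 g_ip _].
move=> /allP h; have [_ _ sp _] := P_res; rewrite -[LHS]sp big1 // => i _.
have := h i (mem_index_enum _); rewrite /= mulf_eq0 gt_eqF //= => /eqP.
exact: inner_product_eq0 g_ip _.
Qed.

Lemma nonpos_operator_resolution :
  nonpos_operator g P <-> forall i, a i <= 0.
Proof.
split=> [h i|h X].
  have [X X0 PX] := resolution_eigenvalue i.
  have := h X; rewrite PX (bilZl gb) /= pmulr_lle0 //.
  by case: g_ip => _ _; apply.
rewrite -oppr_ge0 -(bilNl gb) -fcalc_eigen.
have -> : - fcalc a X = fcalc (fun i => - a i) X.
  by rewrite !fcalcE -sumrN; apply: eq_bigr => i _; rewrite scaleNr.
by apply: fcalc_ge0 => i; rewrite oppr_ge0.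
Qed.

Lemma nonneg_operator_resolution :
  nonneg_operator g P <-> forall i, 0 <= a i.
Proof.
split=> [h i|h X]; last by rewrite -fcalc_eigen; exact: fcalc_ge0.
have [X X0 PX] := resolution_eigenvalue i.
have := h X; rewrite PX (bilZl gb) /= pmulr_lge0 //.
by case: g_ip => _ _; apply.
Qed.

(** The factors 1 - 2 t a_i are all 1 at t = 0, and for increasing t the one with the largest
    positive [a i] is the first to vanish. The last clause records that a finite endpoint comes from
    an eigenvalue, as the proof of maximality requires. *)
Lemma maximal_time :
  exists Tp : \bar R,
  [/\ is_T_plus g P Tp, (0 < Tp)%E,
      forall t, 0 <= t -> (t%:E < Tp)%E -> forall i, 0 < 1 - 2 * t * a i &
      Tp = +oo%E \/
      exists p, [/\ 0 < p, leigenvalue P p & Tp = (2 * p)^-1%:E]].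
Proof.
have [np|nnp] := pselect (nonpos_operator g P).
  exists +oo%E; split => //.
  - by move/nonpos_operator_resolution: np => np t t0 _ i;
    rewrite subr_gt0 (le_lt_trans _ ltr01) // mulr_ge0_le0 // mulr_ge0.
  by left.
have [i0 ai0] : exists i, 0 < a i.
  apply: contrapT => H; apply/nnp/nonpos_operator_resolution => i.
  by rewrite leNgt; apply/negP => ai; apply: H; exists i.
case: (@arg_maxP _ R _ i0 predT a isT) => i1 _ i1m.
have i1max j : a j <= a i1 by exact: i1m.
have ai1 : 0 < a i1 by rewrite (lt_le_trans ai0) ?i1max.
have Li1 : leigenvalue P (a i1) by apply/leigenvalue_resolution; exists i1.
exists (2 * a i1)^-1%:E; split.
- split=> // _; exists (a i1); last by rewrite div1r.
  by split=> // c _ /leigenvalue_resolution[i ->]; apply: i1max.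
- by rewrite lte_fin invr_gt0 mulr_gt0.
- move=> t t0; rewrite lte_fin => tT i; rewrite subr_gt0.
  apply: (@le_lt_trans _ _ (t * (2 * a i1))).
    by rewrite mulrAC mulrC ler_wpM2l // ler_pM2l ?i1max.
  by rewrite -ltr_pdivlMr ?mulr_gt0 // div1r.
by right; exists (a i1); split.
Qed.

Lemma minimal_time :
  exists Tm : \bar R,
  [/\ is_T_minus g P Tm, (Tm < 0)%E,
      forall t, t <= 0 -> (Tm < t%:E)%E -> forall i, 0 < 1 - 2 * t * a i &
      Tm = -oo%E \/
      exists p, [/\ p < 0, leigenvalue P p & Tm = (2 * p)^-1%:E]].
Proof.
have [np|nnp] := pselect (nonneg_operator g P).
  exists -oo%E; split => //.
  - move/nonneg_operator_resolution: np => np t t0 _ i.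
    rewrite subr_gt0 (le_lt_trans _ ltr01) // mulr_le0_ge0 //.
    by rewrite mulr_ge0_le0.
  by left.
have [i0 ai0] : exists i, a i < 0.
  apply: contrapT => H; apply/nnp/nonneg_operator_resolution => i.
  by rewrite leNgt; apply/negP => ai; apply: H; exists i.
case: (@arg_minP _ R _ i0 predT a isT) => i1 _ i1m.
have i1max j : a i1 <= a j by exact: i1m.
have ai1 : a i1 < 0 by rewrite (le_lt_trans _ ai0) ?i1max.
have Li1 : leigenvalue P (a i1) by apply/leigenvalue_resolution; exists i1.
exists (2 * a i1)^-1%:E; split.
- split=> // _; exists (a i1); last by rewrite div1r.
  by split=> // c _ /leigenvalue_resolution[i ->]; apply: i1max.
- by rewrite lte_fin invr_lt0 pmulr_rlt0.
- move=> t t0; rewrite lte_fin => tT i; rewrite subr_gt0.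
  apply: (@le_lt_trans _ _ (t * (2 * a i1))).
    by rewrite mulrAC mulrC ler_wnM2l // ler_pM2l ?i1max.
  by rewrite -ltr_ndivrMr ?pmulr_rlt0 // div1r.
by right; exists (a i1); split.
Qed.
End FunctionalCalculus.

(** * The bracket curve *)

Section BracketCurve.
Variables (R : realType) (V : vectType R).
Local Notation e := (vbasis {:V}%VS).

Lemma is_derive_vectP (f : R -> V) t v :
  is_derive_vect f t v <->
  forall i, is_derive t 1 (fun s => coord e i (f s)) (coord e i v).
Proof.
have fE i : (fun s => coord e i (f s)) = (fun s => rVof e (f s) 0 i).
  by apply/funext => s; rewrite coord_rVof.
split=> [[df dv] i|H].
  move/derivable_mxP/(_ 0 i): (df) => dfi; apply: DeriveDef; rewrite fE //.
  have := derive_mx df; rewrite dv => /matrixP/(_ 0 i).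
  by rewrite !mxE => ->.
have df : derivable (fun s => rVof e (f s)) t 1.
  apply/derivable_mxP => i j; rewrite (ord1 i) -fE.
  by have [] := H j.
apply: DeriveDef => //; rewrite derive_mx //; apply/matrixP => i j.
by rewrite !mxE (ord1 i) -fE; have [_ ->] := H j.
Qed.

Variables (br : V -> V -> V) (P : 'End(V)).
Hypothesis bb : bilinear_for *:%R *:%R br.
Variables (m : nat) (a : 'I_m -> R) (pi : 'I_m -> 'End(V)).
Hypothesis P_res : spectral_resolution P a pi.

(** Separates the scalars from the components of the bracket: when [f] and [h] depend on time, only
    the scalar coefficients on the right vary. *)
Lemma coord_fcalc_bracket (f h : 'I_m -> R) l X Y :
  coord e l (fcalc pi f (br (fcalc pi h X) (fcalc pi h Y))) =
  \sum_k \sum_i \sum_j f k * h i * h j * coord e l (pi k (br (pi i X) (pi j Y))).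
Proof.
rewrite !fcalcE linear_sum; apply: eq_bigr => k _; rewrite linearZ /=.
rewrite (bil_suml bb) !linear_sum mulr_sumr; apply: eq_bigr => i _.
rewrite (bil_sumr bb) !linear_sum mulr_sumr; apply: eq_bigr => j _.
by rewrite (bilZl bb) (bilZr bb) !linearZ /= !mulrA.
Qed.

(* Positive for every [t], because [ln] is 0 on nonpositive arguments; it is the
   square root of [1 - 2 * t * a i] only when that number is positive. *)
Definition sqrt_coeff (t : R) i : R := expR (ln (1 - 2 * t * a i) / 2).
Definition sqrt_op t : 'End(V) := fcalc pi (sqrt_coeff t).
Definition sqrt_op_inv t : 'End(V) := fcalc pi (fun i => (sqrt_coeff t i)^-1).

Lemma sqrt_coeff_gt0 t i : 0 < sqrt_coeff t i.
Proof. exact: expR_gt0. Qed.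

(** Valid at every time, since the coefficients are exponentials and hence nonzero. *)
Lemma sqrt_opK t X : sqrt_op_inv t (sqrt_op t X) = X.
Proof.
rewrite /sqrt_op_inv /sqrt_op (fcalcM P_res) -[RHS](fcalc1 P_res).
by congr (fun_of_lfun _ _); apply: eq_fcalc => i;
  rewrite mulVf // gt_eqF // sqrt_coeff_gt0.
Qed.

Lemma sqrt_opVK t X : sqrt_op t (sqrt_op_inv t X) = X.
Proof.
rewrite /sqrt_op_inv /sqrt_op (fcalcM P_res) -[RHS](fcalc1 P_res).
by congr (fun_of_lfun _ _); apply: eq_fcalc => i;
  rewrite mulfV // gt_eqF // sqrt_coeff_gt0.
Qed.

Lemma sqrt_coeff_sqr t i : 0 < 1 - 2 * t * a i ->
  sqrt_coeff t i * sqrt_coeff t i = 1 - 2 * t * a i.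
Proof.
move=> h; rewrite /sqrt_coeff -expRD -splitr lnK //.
Qed.

Lemma sqrt_op_sqr t : (forall i, 0 < 1 - 2 * t * a i) ->
  (sqrt_op t \o sqrt_op t)%VF = \1%VF - (2 * t) *: P.
Proof.
move=> h; apply/lfunP => Y; rewrite comp_lfunE (fcalcM P_res).
rewrite add_lfunE opp_lfunE scale_lfunE id_lfunE.
rewrite -(fcalc_eigen P_res) -{2}[Y](fcalc1 P_res) !fcalcE scaler_sumr -sumrB.
by apply: eq_bigr => i _; rewrite sqrt_coeff_sqr // scalerBl scalerA.
Qed.

Lemma sqrt_op0 X : sqrt_op 0 X = X.
Proof.
rewrite -[RHS](fcalc1 P_res); congr (fun_of_lfun _ _); apply: eq_fcalc => i.
by rewrite /sqrt_coeff mulr0 mul0r subr0 ln1 mul0r expR0.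
Qed.

(** P0 (I - 2 t P0)^-1, the Chern-Ricci operator along the bracket curve. *)
Definition flow_op t : 'End(V) := fcalc pi (fun i => a i / (1 - 2 * t * a i)).

(** The product is an exponential, so its derivative is itself times that of the exponent; half of
    ln (1 - 2 t a_i) has derivative - a_i / (1 - 2 t a_i). *)
Lemma is_derive_sqrt_coeff_ratio t k i j : (forall i, 0 < 1 - 2 * t * a i) ->
  is_derive t 1
    (fun s => sqrt_coeff s k * (sqrt_coeff s i)^-1 * (sqrt_coeff s j)^-1)
    (sqrt_coeff t k * (sqrt_coeff t i)^-1 * (sqrt_coeff t j)^-1 *
      (a i / (1 - 2 * t * a i) + a j / (1 - 2 * t * a j) - a k / (1 - 2 * t *
        a k))).
Proof.
move=> h.
have E s : sqrt_coeff s k * (sqrt_coeff s i)^-1 * (sqrt_coeff s j)^-1 =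
   expR (2^-1 * (ln (1 - 2 * s * a k) - ln (1 - 2 * s * a i) - ln (1 - 2 * s *
     a j))).
  rewrite /sqrt_coeff -!expRN -!expRD; congr expR; ring.
have dl i' : is_derive t 1 (fun s =>
  ln (1 - 2 * s * a i')) (- 2 * a i' / (1 - 2 * t * a i')).
  have d1 : is_derive t (1 : R) (fun s : R => 1 - 2 * s * a i') (- 2 * a i').
    have -> : (fun s : R =>
      1 - 2 * s * a i') = cst 1 - (2 * a i') \*: (id : R -> R).
      by apply/funext => s; rewrite !fctE; transitivity (1 - (2 * a i') * s);
        [ring|].
    by apply: is_derive_eq; transitivity (0 - (2 * a i') * 1 : R); [|ring].
  have := @is_derive1_comp _ (@ln R) (fun s =>
    1 - 2 * s * a i') t _ _ (is_derive1_ln (h i')) d1.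
  by rewrite mulrC.
rewrite (_ : (fun s => _) = expR \o (2^-1 \*:
  ((fun s => ln (1 - 2 * s * a k)) - (fun s => ln (1 - 2 * s * a i)) -
   (fun s => ln (1 - 2 * s * a j))))); last by apply/funext => s; rewrite E.
have dg := is_deriveZ 2^-1 (is_deriveB (is_deriveB (dl k) (dl i)) (dl j)).
rewrite E; apply: is_derive_eq (is_derive1_comp (is_derive_expR _) dg) _.
rewrite !fctE; congr (_ * _).
have scaleE (x y : R) : x *: y = x * y by [].
rewrite [LHS]scaleE.
have hh i' : 1 - 2 * t * a i' != 0 by rewrite gt_eqF.
by field; rewrite !hh.
Qed.

(** With q_i the eigenvalues of [flow_op], [delta] multiplies the component (k, i, j) of the bracket
    by q_i + q_j - q_k, which is the logarithmic derivative of its coefficient. *)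
Lemma is_derive_sqrt_bracket t X Y : (forall i, 0 < 1 - 2 * t * a i) ->
  is_derive_vect (fun s => gl_act (sqrt_op s) br X Y) t
    (delta (gl_act (sqrt_op t) br) (flow_op t) X Y).
Proof.
move=> h; apply/is_derive_vectP => l.
pose w k i j := coord e l (pi k (br (pi i X) (pi j Y))).
pose c s k i j := sqrt_coeff s k * (sqrt_coeff s i)^-1 * (sqrt_coeff s j)^-1.
pose q i := a i / (1 - 2 * t * a i).
have glE s U W : gl_act (sqrt_op s) br U W =
    sqrt_op s (br (sqrt_op_inv s U) (sqrt_op_inv s W)).
  by apply: gl_actE; [exact: sqrt_opVK | exact: sqrt_opK].
have E : (fun s => coord e l (gl_act (sqrt_op s) br X Y)) =
    \sum_k \sum_i \sum_j (w k i j \*: (fun s => c s k i j)).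
  apply/funext => s; rewrite glE coord_fcalc_bracket fct_sumE.
  apply: eq_bigr => k _; rewrite fct_sumE; apply: eq_bigr => i _.
  by rewrite fct_sumE; apply: eq_bigr => j _; rewrite /GRing.scale /= mulrC.
have -> : coord e l (delta (gl_act (sqrt_op t) br) (flow_op t) X Y) =
    \sum_k \sum_i \sum_j w k i j *: (c t k i j * (q i + q j - q k)).
  rewrite /delta !glE linearB linearD /= [flow_op t (sqrt_op t _)](fcalcM P_res).
  rewrite !coord_fcalc_bracket -big_split -sumrB /=; apply: eq_bigr => k _.
  rewrite -big_split -sumrB /=; apply: eq_bigr => i _.
  rewrite -big_split -sumrB /=; apply: eq_bigr => j _.
  rewrite !(proj_fcalc P_res) (bilZl bb) (bilZr bb) !(linearZ_LR (pi k))
    !(linearZ_LR (coord e l)) /=.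
  rewrite -/(w k i j) -/(q k) -/(q i) -/(q j) /c.
  transitivity (w k i j * (c t k i j * (q i + q j - q k))); last by [].
  by rewrite /c; ring.
rewrite E; apply: is_derive_sum => k; apply: is_derive_sum => i;
  apply: is_derive_sum => j.
apply: is_deriveZ; exact: is_derive_sqrt_coeff_ratio.
Qed.

End BracketCurve.

(** * Uniqueness for the bracket flow *)

Section LocallyLipschitz.
Variables (R : realType) (V : vectType R).
Local Notation e := (vbasis {:V}%VS).
Local Notation d := (\dim {:V}%VS).
Local Notation index := ('I_d * 'I_d * 'I_d)%type.
Local Notation bracket := (V -> V -> V).
Implicit Types (mu nu : bracket) (k : index).

Definition structure_const mu k : R := coord e k.2 (mu e`_k.1.1 e`_k.1.2).
Definition bracket_dist mu nu : R :=
  \sum_k `|structure_const mu k - structure_const nu k|.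
Definition bracket_size mu : R := \sum_k `|structure_const mu k|.

(** Lipschitz on every ball of the l^1 norm of the structure constants. Only bilinear maps are
    compared, because these are determined by their structure constants. *)
Definition loclip (Phi : bracket -> R) : Prop :=
  forall M, exists2 L, 0 <= L & forall mu nu,
    bilinear_for *:%R *:%R mu -> bilinear_for *:%R *:%R nu ->
    bracket_size mu <= M -> bracket_size nu <= M ->
    `|Phi mu - Phi nu| <= L * bracket_dist mu nu.

Definition loclip_vect (Phi : bracket -> V) : Prop :=
  forall l, loclip (fun mu => coord e l (Phi mu)).

Lemma coord_vbasis_full X : X = \sum_i coord e i X *: e`_i.
Proof. exact/coord_vbasis/memvf. Qed.

Lemma bilinear0 : bilinear_for *:%R *:%R (fun _ _ : V => 0 : V).
Proof. by split=> [u x v w|u x v w]; rewrite /= scaler0 addr0. Qed.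

Lemma structure_const0 k : structure_const (fun _ _ => 0) k = 0.
Proof. by rewrite /structure_const linear0. Qed.

Lemma bracket_size0 : bracket_size (fun _ _ => 0) = 0.
Proof. by rewrite /bracket_size big1 // => k _;
  rewrite structure_const0 normr0. Qed.

Lemma bracket_dist0 mu : bracket_dist mu (fun _ _ => 0) = bracket_size mu.
Proof. by apply: eq_bigr => k _; rewrite structure_const0 subr0. Qed.

Lemma bracket_size_ge0 mu : 0 <= bracket_size mu.
Proof. by rewrite sumr_ge0. Qed.

Lemma bracket_dist_ge0 mu nu : 0 <= bracket_dist mu nu.
Proof. by rewrite sumr_ge0. Qed.

(** Comparison with the zero bracket. The absolute value of [M] keeps the bound nonnegative when [M]
    is negative and no bracket qualifies. *)
Lemma loclip_bounded Phi M : loclip Phi ->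
  exists2 B, 0 <= B & forall mu,
    bilinear_for *:%R *:%R mu -> bracket_size mu <= M -> `|Phi mu| <= B.
Proof.
move=> /(_ M)[L L0 HL].
exists (`|Phi (fun _ _ => 0)| + L * `|M|); first by rewrite addr_ge0 // mulr_ge0.
move=> mu hmu sM.
have M0 : 0 <= M := le_trans (bracket_size_ge0 mu) sM.
rewrite -[Phi mu](subrK (Phi (fun _ _ => 0))) addrC.
rewrite (le_trans (ler_normD _ _)) // lerD2l.
rewrite (le_trans (HL _ _ hmu bilinear0 sM _)) ?bracket_size0 //.
by rewrite bracket_dist0 ler_wpM2l // ger0_norm.
Qed.

Lemma loclip_ext Phi Psi :
  (forall mu, bilinear_for *:%R *:%R mu -> Phi mu = Psi mu) ->
  loclip Phi -> loclip Psi.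
Proof.
move=> E hP M; have [L L0 HL] := hP M; exists L => // mu nu hm hn sm sn.
by rewrite -!E //; exact: HL.
Qed.

Lemma loclip_cst c : loclip (fun=> c).
Proof. by move=> M; exists 0 => // mu nu _ _ _ _; rewrite subrr normr0 mul0r. Qed.

Lemma loclipD Phi Psi :
  loclip Phi -> loclip Psi -> loclip (fun mu => Phi mu + Psi mu).
Proof.
move=> hP hQ M; have [L L0 HL] := hP M; have [L' L0' HL'] := hQ M.
exists (L + L'); first by rewrite addr_ge0.
move=> mu nu hm hn sm sn; rewrite opprD addrACA mulrDl.
by rewrite (le_trans (ler_normD _ _)) // lerD // ?HL ?HL'.
Qed.

Lemma loclipM Phi Psi :
  loclip Phi -> loclip Psi -> loclip (fun mu => Phi mu * Psi mu).
Proof.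
move=> hP hQ M; have [L L0 HL] := hP M; have [L' L0' HL'] := hQ M.
have [B B0 HB] := loclip_bounded M hP; have [B' B0' HB'] := loclip_bounded M hQ.
exists (B * L' + B' * L); first by rewrite addr_ge0 // mulr_ge0.
move=> mu nu hm hn sm sn.
have -> : Phi mu * Psi mu - Phi nu * Psi nu =
  Phi mu * (Psi mu - Psi nu) + Psi nu * (Phi mu - Phi nu) by ring.
rewrite (le_trans (ler_normD _ _)) // !normrM mulrDl -!mulrA.
by rewrite lerD // ler_pM // ?HB ?HB' ?HL ?HL'.
Qed.

Lemma loclip_sum I (r : seq I) (F : I -> bracket -> R) :
  (forall i, loclip (F i)) -> loclip (fun mu => \sum_(i <- r) F i mu).
Proof.
move=> hF; elim: r => [|i r IH].
  by apply: loclip_ext (loclip_cst 0) => mu _; rewrite big_nil.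
by apply: loclip_ext (loclipD (hF i) IH) => mu _; rewrite big_cons.
Qed.

Lemma loclip_structure_const k : loclip (structure_const^~ k).
Proof.
move=> M; exists 1 => // mu nu _ _ _ _; rewrite mul1r /bracket_dist (bigD1 k) //=.
by rewrite lerDl sumr_ge0.
Qed.

Lemma loclip_vect_cst X : loclip_vect (fun=> X).
Proof. by move=> l; exact: loclip_cst. Qed.

Lemma loclip_vectD Phi Psi :
  loclip_vect Phi -> loclip_vect Psi -> loclip_vect (fun mu => Phi mu + Psi mu).
Proof.
move=> hP hQ l; apply: loclip_ext (loclipD (hP l) (hQ l)) => mu _.
by rewrite linearD.
Qed.

Lemma loclip_vectZ (phi : bracket -> R) Phi :
  loclip phi -> loclip_vect Phi -> loclip_vect (fun mu => phi mu *: Phi mu).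
Proof.
move=> hp hP l; apply: loclip_ext (loclipM hp (hP l)) => mu _.
by rewrite linearZ.
Qed.

Lemma loclip_vectN Phi : loclip_vect Phi -> loclip_vect (fun mu => - Phi mu).
Proof.
move=> hP l; apply: loclip_ext (loclipM (loclip_cst (-1)) (hP l)) => mu _.
by rewrite linearN mulN1r.
Qed.

Lemma loclip_vect_sum I (r : seq I) (F : I -> bracket -> V) :
  (forall i, loclip_vect (F i)) -> loclip_vect (fun mu => \sum_(i <- r) F i mu).
Proof.
move=> hF l; apply: loclip_ext (loclip_sum r (fun i => hF i l)) => mu _.
by rewrite linear_sum.
Qed.

Lemma loclip_vect_lfun (A : 'End(V)) Phi :
  loclip_vect Phi -> loclip_vect (fun mu => A (Phi mu)).
Proof.
move=> hP l.
apply: (@loclip_ext (fun mu => \sum_i coord e i (Phi mu) * coord e l (A e`_i))).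
  move=> mu _; rewrite [X in A X]coord_vbasis_full !linear_sum.
  by apply: eq_bigr => i _; rewrite !linearZ.
by apply: loclip_sum => i; apply: loclipM => //; exact: loclip_cst.
Qed.

(** Expanding both arguments in the basis turns each coordinate into a sum of products of locally
    Lipschitz functions. *)
Lemma loclip_vect_app Phi Psi :
  loclip_vect Phi -> loclip_vect Psi ->
  loclip_vect (fun mu => mu (Phi mu) (Psi mu)).
Proof.
move=> hP hQ l.
apply: (@loclip_ext (fun mu => \sum_i \sum_j
  coord e i (Phi mu) * coord e j (Psi mu) * structure_const mu (i, j, l))).
  move=> mu hm; rewrite [X in mu X]coord_vbasis_full [X in mu _
    X]coord_vbasis_full.
  rewrite (bil_suml hm) linear_sum; apply: eq_bigr => i _.
  rewrite (bil_sumr hm) linear_sum; apply: eq_bigr => j _.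
  by rewrite (bilZl hm) (bilZr hm) !linearZ /= mulrA.
apply: loclip_sum => i; apply: loclip_sum => j; apply: loclipM.
  exact: loclipM.
exact: loclip_structure_const.
Qed.

Lemma loclip_lftrace_ad (A : 'End(V)) Phi : loclip_vect Phi ->
  loclip (fun mu => lftrace (A \o ad mu (Phi mu))%VF).
Proof.
move=> hP.
apply: (@loclip_ext (fun mu => \sum_i coord e i (A (mu (Phi mu) e`_i)))).
  move=> mu hm; rewrite lftraceE; apply: eq_bigr => i _.
  by rewrite comp_lfunE linfunE //; exact: hm.2.
apply: loclip_sum => i; apply: loclip_vect_lfun; apply: loclip_vect_app => //.
exact: loclip_vect_cst.
Qed.

Lemma loclip_chern_ricci_form (J : 'End(V)) Phi Psi :
  loclip_vect Phi -> loclip_vect Psi ->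
  loclip (fun mu => chern_ricci_form mu J (Phi mu) (Psi mu)).
Proof.
move=> hP hQ; have hb := loclip_vect_app hP hQ.
have h1 := loclipM (loclip_cst (- 2^-1)) (loclip_lftrace_ad J hb).
have h2 := loclipM (loclip_cst 2^-1)
  (loclip_lftrace_ad \1%VF (loclip_vect_lfun J hb)).
apply: loclip_ext (loclipD h1 h2) => mu _.
by rewrite comp_lfun1l mulNr.
Qed.

(** The map sending X to the row of the [om X e_j] is injective by non-degeneracy; the [f j] are the
    images of the unit rows under a left inverse. *)
Lemma nondegenerate_dual_basis (om : V -> V -> R) : nondegenerate_2form om ->
  exists f : 'I_d -> V, forall X, X = \sum_(j < d) om X e`_j *: f j.
Proof.
case=> ob _ nd.
have lB : linear (fun X => \row_(j < d) om X e`_j : 'rV[R]_d).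
  by move=> a X Y; apply/rowP => j; rewrite !mxE (bilDl ob) (bilZl ob).
pose B : 'Hom(V, 'rV[R]_d) := linfun (fun X => \row_(j < d) om X e`_j).
have BE X : B X = \row_(j < d) om X e`_j by rewrite linfunE.
have kB : lker B == 0%VS.
  apply/lker0P => X Y; rewrite !BE => /rowP h.
  apply/eqP; rewrite -subr_eq0; apply/eqP; apply: nd => Z.
  rewrite (coord_vbasis_full Z) (bil_sumr ob) big1 // => j _.
  by rewrite (bilZr ob) (bilBl ob); have := h j; rewrite !mxE => ->;
    rewrite subrr /= mulr0.
exists (fun j => (B^-1)%VF (delta_mx 0 j)) => X.
rewrite -{1}[X](lker0_lfunK kB) BE (row_sum_delta (\row_(j < d) _)) linear_sum.
by apply: eq_bigr => j _; rewrite linearZ /= mxE.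
Qed.

(* The bracket flow as an autonomous equation: [f] is a basis dual to
   [vbasis {:V}] for [om], so the sum is the Chern-Ricci operator of [mu]. *)
Definition chern_ricci_map (J : 'End(V)) (f : 'I_d -> V) mu X : V :=
  \sum_(j < d) chern_ricci_form mu J X e`_j *: f j.

Lemma chern_ricci_mapE J f om mu P X :
  (forall X, X = \sum_(j < d) om X e`_j *: f j) -> chern_ricci_operator mu J
    om P ->
  P X = chern_ricci_map J f mu X.
Proof.
by move=> hf hP; rewrite [LHS]hf; apply: eq_bigr => j _; rewrite hP.
Qed.

Lemma loclip_vect_chern_ricci_map J f Phi :
  loclip_vect Phi -> loclip_vect (fun mu => chern_ricci_map J f mu (Phi mu)).
Proof.
move=> hP; apply: loclip_vect_sum => j; apply: loclip_vectZ.
  by apply: loclip_chern_ricci_form => //; exact: loclip_vect_cst.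
exact: loclip_vect_cst.
Qed.

(** [delta] with the operator expressed through [mu], so that the right-hand side of the flow is a
    function of the bracket alone. *)
Definition flow_field J f mu X Y : V :=
  mu (chern_ricci_map J f mu X) Y + mu X (chern_ricci_map J f mu Y)
  - chern_ricci_map J f mu (mu X Y).

Lemma loclip_vect_flow_field J f X Y :
  loclip_vect (fun mu => flow_field J f mu X Y).
Proof.
have cX := loclip_vect_cst X; have cY := loclip_vect_cst Y.
apply: loclip_vectD; last first.
  apply: loclip_vectN; apply: (@loclip_vect_chern_ricci_map J f (fun mu =>
    mu X Y)).
  exact: loclip_vect_app cX cY.
apply: loclip_vectD.
  exact: loclip_vect_app (loclip_vect_chern_ricci_map J f cX) cY.
exact: loclip_vect_app cX (loclip_vect_chern_ricci_map J f cY).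
Qed.

End LocallyLipschitz.

(** * Gronwall's inequality *)

Section Gronwall.
Variable R : realType.
Implicit Types (F dF : R -> R).
Local Open Scope classical_set_scope.

Lemma is_derive_bigsum I (r : seq I) (f : I -> R -> R) (df : I -> R) (t : R) :
  (forall i, is_derive t 1 (f i) (df i)) ->
  is_derive t 1 (fun s => \sum_(i <- r) f i s) (\sum_(i <- r) df i).
Proof.
move=> h; elim: r => [|i r IH].
  under eq_fun do rewrite big_nil; rewrite big_nil.
  exact: is_derive_cst.
under eq_fun do rewrite big_cons; rewrite big_cons.
exact: is_deriveD.
Qed.

Lemma derivable_segment_continuous F u v :
  (forall s, u <= s <= v -> derivable F s 1) ->
  {within `[u, v], continuous F}.
Proof.
move=> h; apply: derivable_within_continuous => s.
by rewrite in_itv => /h.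
Qed.

Lemma derivable_segment_bounded F u v :
  (forall s, u <= s <= v -> derivable F s 1) ->
  exists M, forall s, u <= s <= v -> `|F s| <= M.
Proof.
move=> h; have [uv|vu] := leP u v; last first.
  by exists 0 => s /andP[us sv]; have := le_trans us sv; rewrite leNgt vu.
have cF := derivable_segment_continuous h.
have [c _ hc] := EVT_max uv cF; have [c' _ hc'] := EVT_min uv cF.
exists (`|F c| + `|F c'|) => s suv.
have sI : s \in `[u, v]%R by rewrite in_itv.
have := hc s sI; have := hc' s sI => l1 l2.
have := ler_norm (F c); have := ler_norm (- F c'); rewrite normrN.
have := normr_ge0 (F c); have := normr_ge0 (F c') => n1 n2 n3 n4.
by rewrite ler_norml; apply/andP; split; lra.
Qed.

(** The function F(s) exp(- C s) is nonincreasing on the segment. *)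
Lemma gronwall_right F dF (C T : R) : 0 <= T ->
  (forall s, 0 <= s <= T -> is_derive s 1 F (dF s) /\ dF s <= C * F s) ->
  F 0 <= 0 -> F T <= 0.
Proof.
move=> T0 h F0.
pose H s := F s * expR (- C * s).
have dH s : 0 <= s <= T ->
    is_derive s 1 H (F s * (- C * expR (- C * s)) + expR (- C * s) * dF s).
  move=> /h[d1 _].
  have d2 : is_derive s (1 : R) (fun s : R =>
    expR (- C * s)) (- C * expR (- C * s)).
    have d3 := is_deriveZ (- C) (is_derive_id s (1 : R)).
    apply: is_derive_eq (is_derive1_comp (is_derive_expR _) d3) _.
    by transitivity (expR (- C * s) * (- C * 1)); [|rewrite mulr1 mulrC].
  exact: is_deriveM.
have HT : H T <= H 0.
  apply: (@ler0_derive1_nincr _ H 0 T) => //.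
  - by move=> s; rewrite in_itv /= => /andP[s0 sT]; have [] := dH s; rewrite ?ltW.
  - move=> s; rewrite in_itv /= => /andP[s0 sT].
    have sI : 0 <= s <= T by rewrite !ltW.
    have [_ Fs] := h s sI; rewrite derive1E; have [_ ->] := dH s sI.
    have E0 := expR_gt0 (- C * s).
    have -> : F s * (- C * expR (- C * s)) + expR (- C * s) * dF s =
      expR (- C * s) * (dF s - C * F s) by ring.
    by rewrite pmulr_rle0 // subr_le0.
  - by apply: derivable_segment_continuous => s /dH[].
have : H T <= 0.
  by rewrite (le_trans HT) // /H mulr_le0_ge0 // ltW // expR_gt0.
by rewrite /H pmulr_lle0 ?expR_gt0.
Qed.

(** Time reversal reduces this to nonnegative times. *)
Lemma gronwall_left F dF (C T : R) : T <= 0 ->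
  (forall s, T <= s <= 0 -> is_derive s 1 F (dF s) /\ - dF s <= C * F s) ->
  F 0 <= 0 -> F T <= 0.
Proof.
move=> T0 h F0; rewrite -[T]opprK.
apply: (@gronwall_right (fun s => F (- s)) (fun s => - dF (- s)) C (- T)).
- by rewrite oppr_ge0.
- move=> s /andP[s0 sT].
  have sI : T <= - s <= 0 by rewrite lerNr sT oppr_le0.
  have [d1 dle] := h _ sI; split=> //.
  have dN := is_deriveNid s (1 : R).
  by apply: is_derive_eq (@is_derive1_comp _ F -%R s _ _ d1 dN) _; rewrite mulrN1.
- by rewrite oppr0.
Qed.

Lemma gronwall_eq0 F dF (C T : R) :
  (forall s, 0 <= F s) ->
  (forall s, Num.min 0 T <= s <= Num.max 0 T ->
     is_derive s 1 F (dF s) /\ `|dF s| <= C * F s) ->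
  F 0 = 0 -> F T = 0.
Proof.
move=> F0 h F00; apply/eqP; rewrite eq_le F0 andbT.
have [T0|T0] := leP 0 T.
  apply: (@gronwall_right F dF C T) => //; last by rewrite F00.
  move=> s sI; have [] := h s; first by rewrite min_l // max_r.
  by move=> d1 le1; split=> //; exact: le_trans (ler_norm _) le1.
apply: (@gronwall_left F dF C T); [exact: ltW| |by rewrite F00].
move=> s sI; have [] := h s; first by rewrite min_r ?max_l // ltW.
by move=> d1 le1; split=> //; rewrite (le_trans _ le1) // -normrN ler_norm.
Qed.
End Gronwall.

(** * Uniqueness of bracket flow solutions *)

Section FlowUniqueness.
Variables (R : realType) (V : vectType R).
Local Notation e := (vbasis {:V}%VS).
Local Notation d := (\dim {:V}%VS).
Local Notation index := ('I_d * 'I_d * 'I_d)%type.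

(** Sum 2 x_i x_j <= x_i^2 + x_j^2 over all pairs. This bounds the l^1 distance by the sum of
    squares, which unlike it is differentiable in time. *)
Lemma sqr_sum_le (I : finType) (x : I -> R) :
  (\sum_i x i) * (\sum_i x i) <= #|I|%:R * \sum_i x i * x i.
Proof.
have E : #|I|%:R * \sum_i x i * x i =
    \sum_i \sum_j (x i * x i + x j * x j) / 2.
  under [RHS]eq_bigr do rewrite -mulr_suml big_split /= sumr_const.
  rewrite -mulr_suml big_split /= sumr_const -[X in _ + X]mulr_natl.
  under [X in X + _]eq_bigr do rewrite -mulr_natl.
  by rewrite -mulr_sumr; field.
rewrite E mulr_suml ler_sum // => i _; rewrite mulr_sumr ler_sum // => j _.
have := sqr_ge0 (x i - x j); rewrite expr2 => h.
by lra.
Qed.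

Lemma structure_const_inj (mu nu : V -> V -> V) :
  bilinear_for *:%R *:%R mu -> bilinear_for *:%R *:%R nu ->
  (forall k, structure_const mu k = structure_const nu k) ->
  forall X Y, mu X Y = nu X Y.
Proof.
move=> hm hn E X Y; rewrite (coord_vbasis_full X) (coord_vbasis_full Y).
rewrite (bil_suml hm) (bil_suml hn); apply: eq_bigr => i _.
rewrite (bil_sumr hm) (bil_sumr hn); apply: eq_bigr => j _.
rewrite !(bilZl hm) !(bilZl hn) !(bilZr hm) !(bilZr hn) /=; congr (_ *: (_ *: _)).
rewrite (coord_vbasis_full (mu _ _)) (coord_vbasis_full (nu _ _)).
by apply: eq_bigr => l _; have := E (i, j, l); rewrite /structure_const /= => ->.
Qed.

Lemma between_in_interval (a b : \bar R) (T s : R) :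
  (a < 0 < b)%E -> (a < T%:E < b)%E ->
  Num.min 0 T <= s <= Num.max 0 T -> (a < s%:E < b)%E.
Proof.
move=> /andP[a0 b0] /andP[aT bT] /andP[ms sM]; apply/andP; split.
  apply: (@lt_le_trans _ _ (Num.min 0 T)%:E); last by rewrite lee_fin.
  by rewrite /Num.min; case: ifP.
apply: (@le_lt_trans _ _ (Num.max 0 T)%:E); first by rewrite lee_fin.
by rewrite /Num.max; case: ifP.
Qed.

Variables (br : V -> V -> V) (J : 'End(V)) (om : V -> V -> R).
Hypothesis om_nd : nondegenerate_2form om.

Lemma bracket_flow_restrict mu (a b a' b' : \bar R) : (a <= a')%E -> (b' <=
  b)%E ->
  bracket_flow br J om a b mu -> bracket_flow br J om a' b' mu.
Proof.
move=> aa' bb' [m0 hm]; split=> // t /andP[at' tb']; apply: hm.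
by rewrite (le_lt_trans aa') // (lt_le_trans tb').
Qed.

Lemma bracket_flow_structure_const (f : 'I_d -> V) mu a b :
  (forall X, X = \sum_(j < d) om X e`_j *: f j) ->
  bracket_flow br J om a b mu -> forall t, (a < t%:E < b)%E -> forall k,
  is_derive t 1 (fun s => structure_const (mu s) k)
    (coord e k.2 (flow_field J f (mu t) e`_k.1.1 e`_k.1.2)).
Proof.
move=> hf [_ hm] t ht k; have [_ [P hP dP]] := hm t ht.
have := (is_derive_vectP _ _ _).1 (dP e`_k.1.1 e`_k.1.2) k.2.
by rewrite /delta !(chern_ricci_mapE _ hf hP).
Qed.

(** Structure constants are differentiable in time, hence bounded on a segment. The bound is the
    radius at which Lipschitz constants are chosen. *)
Lemma bracket_flow_bounded mu a b u v : bracket_flow br J om a b mu ->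
  (forall s, u <= s <= v -> (a < s%:E < b)%E) ->
  exists M, forall s, u <= s <= v -> bracket_size (mu s) <= M.
Proof.
move=> hm hI; have [f hf] := nondegenerate_dual_basis om_nd.
have /choice[M hM] : forall k : index, exists M, forall s, u <= s <= v ->
    `|structure_const (mu s) k| <= M.
  move=> k; apply: derivable_segment_bounded => s /hI hs.
  by have [] := bracket_flow_structure_const hf hm hs k.
exists (\sum_k M k) => s hs; apply: ler_sum => k _; exact: hM.
Qed.

(** Gronwall's inequality for [F], the sum of the squared differences of structure constants,
    between time 0 and [t]. *)
Lemma bracket_flow_uniq mu nu (a b : \bar R) : (a < 0 < b)%E ->
  bracket_flow br J om a b mu -> bracket_flow br J om a b nu ->
  forall t, (a < t%:E < b)%E -> forall X Y, mu t X Y = nu t X Y.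
Proof.
move=> ab0 hm hn t tab; have [f hf] := nondegenerate_dual_basis om_nd.
pose u := Num.min 0 t; pose v := Num.max 0 t.
have hI s : u <= s <= v -> (a < s%:E < b)%E := between_in_interval ab0 tab.
have [M1 hM1] := bracket_flow_bounded hm hI.
have [M2 hM2] := bracket_flow_bounded hn hI.
pose M := Num.max M1 M2.
have bil mu' s : bracket_flow br J om a b mu' -> (a < s%:E < b)%E ->
    bilinear_for *:%R *:%R (mu' s).
  by case=> _ h /h[[]].
pose G nu' (k : index) := coord e k.2 (flow_field J f nu' e`_k.1.1 e`_k.1.2).
have /choice[L hL] : forall k : index, exists L, 0 <= L /\ forall mu nu,
    bilinear_for *:%R *:%R mu -> bilinear_for *:%R *:%R nu ->
    bracket_size mu <= M -> bracket_size nu <= M ->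
    `|G mu k - G nu k| <= L * bracket_dist mu nu.
  move=> k; have [L L0 HL] := loclip_vect_flow_field J f e`_k.1.1 e`_k.1.2 k.2 M.
  by exists L.
pose D k s := structure_const (mu s) k - structure_const (nu s) k.
pose dD k s := G (mu s) k - G (nu s) k.
pose F s := \sum_k D k s * D k s.
have F0 s : 0 <= F s by rewrite sumr_ge0 // => k _; rewrite -expr2 sqr_ge0.
suff Ft : F t = 0.
  apply: structure_const_inj; [exact: bil tab|exact: bil tab|] => k.
  move/eqP: Ft; rewrite psumr_eq0; last by move=> i _; rewrite -expr2 sqr_ge0.
  move=> /allP/(_ k (mem_index_enum _)); rewrite /= mulf_eq0 orbb subr_eq0.
  by move/eqP.
(* The 2 comes from differentiating a square, the sum of the [L k] dominates each Lipschitz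
   constant, and the number of indices comes from [sqr_sum_le]. *)
pose C := 2 * (\sum_k L k) * #|{: index}|%:R.
apply: (@gronwall_eq0 _ F (fun s =>
  \sum_k (D k s * dD k s + D k s * dD k s)) C) => //.
  move=> s sI; have sab := hI s sI; split.
    apply: is_derive_bigsum => k.
    have dDk : is_derive s 1 (D k) (dD k s).
      apply: is_deriveB; first exact: bracket_flow_structure_const hf hm s sab k.
      exact: bracket_flow_structure_const hf hn s sab k.
    exact: (is_deriveM dDk dDk).
  have hms : bracket_size (mu s) <= M by rewrite /M le_max hM1.
  have hns : bracket_size (nu s) <= M by rewrite /M le_max hM2 ?orbT.
  pose dist := bracket_dist (mu s) (nu s).
  have dist0 : 0 <= dist := bracket_dist_ge0 _ _.
  have le1 k : `|D k s * dD k s + D k s * dD k s| <= 2 * (\sum_k L k) * dist *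
    `|D k s|.
    have [L0 HL] := hL k.
    have h1 : `|dD k s| <= (\sum_k L k) * dist.
      rewrite (le_trans (HL _ _ (bil _ _ hm sab) (bil _ _ hn sab) hms hns)) //.
      rewrite ler_wpM2r // (bigD1 k) //= lerDl sumr_ge0 // => i _.
      by have [] := hL i.
    have -> : D k s * dD k s + D k s * dD k s = 2 * (D k s * dD k s) by ring.
    rewrite !normrM (ger0_norm (ler0n _ 2)) -!mulrA ler_wpM2l //.
    by rewrite mulrC mulrA ler_wpM2r.
  rewrite (le_trans (ler_norm_sum _ _ _)) //.
  rewrite (le_trans (ler_sum _ (fun k _ => le1 k))) // -mulr_sumr.
  rewrite /C -!mulrA ler_wpM2l // ler_wpM2l //.
    by rewrite sumr_ge0 // => i _; have [] := hL i.
  apply: le_trans (sqr_sum_le (fun k => `|D k s|)) _.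
  rewrite ler_wpM2l // ler_sum // => k _.
  by rewrite -normrM ger0_norm // -expr2 sqr_ge0.
rewrite /F big1 // => k _; rewrite /D /structure_const.
by case: hm => -> _; case: hn => -> _; rewrite subrr mul0r.
Qed.

End FlowUniqueness.

(** * The two flows *)

Section FlowsOfHermitianStructure.
Variables (R : realType) (V : vectType R) (br : V -> V -> V) (J : 'End(V)).
Variables (om0 g0 : V -> V -> R) (P0 : 'End(V)).
Hypothesis br_lie : lie_bracket br.
Hypothesis herm0 : hermitian_structure br J om0 g0.
Hypothesis P0_cr : chern_ricci_operator br J om0 P0.
Variables (m : nat) (a : 'I_m -> R) (pi : 'I_m -> 'End(V)).
Hypothesis P_res : spectral_resolution P0 a pi.
Hypothesis pi_sym : forall i X Y, g0 (pi i X) Y = g0 X (pi i Y).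
Hypothesis pi_J : forall i X, J (pi i X) = pi i (J X).

Let g_ip : inner_product g0. Proof. by case: herm0. Qed.
Let gb : bilinear_for *%R *%R g0. Proof. by case: g_ip. Qed.
Let om_nd : nondegenerate_2form om0. Proof. by case: herm0. Qed.
Let ob : bilinear_for *%R *%R om0. Proof. by case: om_nd. Qed.
Let omE X Y : om0 X Y = g0 (J X) Y. Proof. by case: herm0. Qed.
Let JJ X : J (J X) = - X. Proof. by case: herm0. Qed.
Let bb : bilinear_for *:%R *:%R br. Proof. by case: br_lie. Qed.

Definition affine_form t X Y : R := om0 X Y - 2 * t * chern_ricci_form br J X Y.
Definition affine_metric t X Y : R := affine_form t X (J Y).

Lemma affine_formE t X Y :
  affine_form t X Y = om0 ((\1%VF - (2 * t) *: P0) X) Y.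
Proof.
rewrite /affine_form P0_cr add_lfunE opp_lfunE scale_lfunE id_lfunE.
by rewrite (bilBl ob) (bilZl ob).
Qed.

Let A t := fcalc pi (fun i => 1 - 2 * t * a i).

Let AE t X : (\1%VF - (2 * t) *: P0) X = A t X.
Proof.
rewrite add_lfunE opp_lfunE scale_lfunE id_lfunE.
rewrite -(fcalc_eigen P_res) -{1}[X](fcalc1 P_res) !fcalcE scaler_sumr -sumrB.
by apply: eq_bigr => i _; rewrite scalerBl scalerA.
Qed.

Let fcalc_J f X : J (fcalc pi f X) = fcalc pi f (J X).
Proof. exact: fcalc_comm. Qed.

Let om_fcalc f X Y : om0 (fcalc pi f X) Y = om0 X (fcalc pi f Y).
Proof. by rewrite !omE fcalc_J (fcalc_sym g_ip pi_sym). Qed.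

(** I - 2 t P0 is then positive definite, [g0]-symmetric and commutes with [J]. Non-degeneracy of
    the form follows from positivity of the metric. *)
Lemma affine_hermitian t : (forall i, 0 < 1 - 2 * t * a i) ->
  hermitian_structure br J (affine_form t) (affine_metric t).
Proof.
move=> pos.
have omA X Y : affine_form t X Y = om0 (A t X) Y by rewrite affine_formE AE.
have gA X Y : affine_metric t X Y = g0 (A t X) Y by rewrite /affine_metric omA
  -(hermitian_gE herm0).
have gpos X : X != 0 -> 0 < affine_metric t X X.
  by move=> X0; rewrite gA (fcalc_gt0 P_res g_ip pi_sym).
split=> //.
- split.
  + split=> [Y c X Z|X c Y Z]; rewrite !omA.
      by rewrite linearP (bilDl ob) (bilZl ob).
    by rewrite (bilDr ob) (bilZr ob).
  + move=> X; rewrite omA; have := hermitian_omC herm0 (A t X) X.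
    by rewrite -om_fcalc; lra.
  + move=> X h; apply/eqP; apply: contraT => /gpos.
    by rewrite /affine_metric h ltxx.
- split=> //.
  + split=> [Y c X Z|X c Y Z]; rewrite !gA.
      by rewrite linearP (bilDl gb) (bilZl gb).
    by rewrite (bilDr gb) (bilZr gb).
  + by move=> X Y; rewrite !gA (fcalc_sym g_ip pi_sym); case: g_ip => _ ->.
- by move=> X Y; rewrite omA gA omE fcalc_J.
- by case: herm0.
Qed.

Lemma is_derive_affine_form (t : R) X Y :
  is_derive t 1 (fun s => affine_form s X Y) (- 2 * chern_ricci_form br J X Y).
Proof.
set p := chern_ricci_form br J X Y.
have -> : (fun s => affine_form s X Y) = cst (om0 X Y) - (2 * p) \*: (id : R
  -> R).
  apply/funext => s; rewrite !fctE.
  by transitivity (om0 X Y - (2 * p) * s); [rewrite /affine_form -/p; ring|].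
by apply: is_derive_eq; transitivity (0 - (2 * p) * 1 : R); [|ring].
Qed.

Lemma affine_flow (Tm Tp : \bar R) :
  (forall t, (Tm < t%:E < Tp)%E -> forall i, 0 < 1 - 2 * t * a i) ->
  chern_ricci_flow br J om0 g0 Tm Tp affine_form affine_metric.
Proof.
move=> good; split.
- by move=> X Y; rewrite /affine_form mulr0 mul0r subr0.
- by move=> X Y; rewrite /affine_metric /affine_form mulr0 mul0r subr0
  -(hermitian_gE herm0).
move=> t /good ht; split; first exact: affine_hermitian.
exact: is_derive_affine_form.
Qed.

(** Both forms have the same derivative and initial value, so the squared difference has derivative
    0 and Gronwall applies with constant 0. The metric is recovered from the form through [J]. *)
Lemma chern_ricci_flow_uniq (T1 T2 : \bar R) om' g' : (T1 < 0 < T2)%E ->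
  chern_ricci_flow br J om0 g0 T1 T2 om' g' ->
  forall t, (T1 < t%:E < T2)%E ->
  forall X Y, om' t X Y = affine_form t X Y /\ g' t X Y = affine_metric t X Y.
Proof.
move=> T0 [om'0 g'0 hf] t tT.
have omt X Y : om' t X Y = affine_form t X Y.
  pose D s := om' s X Y - affine_form s X Y.
  suff DD : D t * D t = 0.
    by move/eqP: DD; rewrite mulf_eq0 orbb subr_eq0 => /eqP.
  apply: (@gronwall_eq0 _ (fun s => D s * D s) (fun=> 0) 0).
  - by move=> s; rewrite -expr2 sqr_ge0.
  - move=> s sI; rewrite normr0 mul0r; split=> //.
    have [_ d1] := hf s (between_in_interval T0 tT sI).
    have dD : is_derive s 1 D 0.
      apply: is_derive_eq (is_deriveB (d1 X Y) (is_derive_affine_form s X Y)) _.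
      by rewrite subrr.
    by apply: is_derive_eq (is_deriveM dD dD) _; rewrite !scaler0 addr0.
  - by rewrite /D om'0 /affine_form mulr0 mul0r subr0 subrr mul0r.
move=> X Y; split=> //; have [ht _] := hf t tT.
by rewrite (hermitian_gE ht) omt.
Qed.

(** At t = 1/(2p) an eigenvector for [p] lies in the kernel of I - 2 t P0, so the form would be
    degenerate there. *)
Lemma chern_ricci_flow_stops (T1 T2 : \bar R) om' g' p : (T1 < 0 < T2)%E ->
  chern_ricci_flow br J om0 g0 T1 T2 om' g' ->
  p != 0 -> leigenvalue P0 p -> ~ (T1 < (2 * p)^-1%:E < T2)%E.
Proof.
move=> T0 hf p0 /leigenvalueP[X X0 PX] tT.
have [_ _ ht] := hf; have [[[_ _ nd] _ _ _ _] _] := ht _ tT.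
move/eqP: X0; apply; apply: nd => Y.
have [-> _] := chern_ricci_flow_uniq T0 hf tT X Y.
rewrite affine_formE add_lfunE opp_lfunE scale_lfunE id_lfunE PX scalerA.
rewrite (_ : 2 * (2 * p)^-1 * p = 1); last by field.
by rewrite scale1r subrr (bil0l ob).
Qed.

(** * The explicit bracket curve and its blow-up *)

Local Notation h := (sqrt_op a pi).
Local Notation k := (sqrt_op_inv a pi).
Definition sqrt_bracket t : V -> V -> V := gl_act (h t) br.

Let hk t X : h t (k t X) = X. Proof. exact: (sqrt_opVK P_res). Qed.
Let kh t X : k t (h t X) = X. Proof. exact: (sqrt_opK P_res). Qed.
Let hJ t X : h t (J X) = J (h t X). Proof. by rewrite fcalc_J. Qed.

Lemma sqrt_op_pos_sqrt t : (forall i, 0 < 1 - 2 * t * a i) ->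
  pos_sqrt g0 (\1%VF - (2 * t) *: P0) (h t).
Proof.
move=> pos; split; first exact: sqrt_op_sqr.
- by move=> X Y; exact: fcalc_sym.
- move=> X; apply: (fcalc_gt0 P_res g_ip pi_sym) => i; exact: sqrt_coeff_gt0.
Qed.

Lemma sqrt_bracket_lie t : lie_bracket (sqrt_bracket t).
Proof. exact: gl_act_lie_bracket (hk t) (kh t) br_lie. Qed.

Lemma sqrt_bracket_hermitian t : hermitian_structure (sqrt_bracket t) J om0 g0.
Proof.
have [? ? ? ? J_int] := herm0; split=> //.
exact: gl_act_integrable (hk t) (kh t) (hJ t) J_int.
Qed.

Lemma sqrt_bracket_chern_ricci_form t X Y :
  chern_ricci_form (sqrt_bracket t) J X Y = om0 (k t (P0 (k t X))) Y.
Proof.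
rewrite (gl_act_chern_ricci_form (hk t) (kh t) br_lie (hJ t)) P0_cr.
by rewrite -om_fcalc.
Qed.

(** The operator of the transported bracket is h^-1 P0 h^-1, whose factors commute, and h^2 = I - 2
    t P0. *)
Lemma sqrt_bracket_chern_ricci_operator t : (forall i, 0 < 1 - 2 * t * a i) ->
  chern_ricci_operator (sqrt_bracket t) J om0 (flow_op a pi t).
Proof.
move=> pos X Y; rewrite sqrt_bracket_chern_ricci_form; congr om0.
rewrite -(fcalc_eigen P_res) /sqrt_op_inv !(fcalcM P_res).
congr (fun_of_lfun _ _); apply: eq_fcalc => i.
by rewrite mulrAC -invfM sqrt_coeff_sqr // mulrC.
Qed.

Lemma sqrt_bracket_flow (Tm Tp : \bar R) :
  (forall t, (Tm < t%:E < Tp)%E -> forall i, 0 < 1 - 2 * t * a i) ->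
  bracket_flow br J om0 Tm Tp sqrt_bracket.
Proof.
move=> good; split=> [X Y|t /good pos].
  rewrite /sqrt_bracket (gl_actE br (hk 0) (kh 0)).
  have k0 Z : k 0 Z = Z by rewrite -[LHS](sqrt_op0 P_res) hk.
  by rewrite !k0; exact: (sqrt_op0 P_res).
split; first exact: sqrt_bracket_lie.
exists (flow_op a pi t); first exact: sqrt_bracket_chern_ricci_operator.
by move=> X Y; exact: (is_derive_sqrt_bracket bb P_res).
Qed.

(* P_mu(t) has the eigenvalue p / (1 - 2 t p), although it is polynomial in
  mu(t). *)
Lemma sqrt_bracket_blow_up t p X : (forall i, 0 < 1 - 2 * t * a i) ->
  P0 X = p *: X ->
  (1 - 2 * t * p) * chern_ricci_form (sqrt_bracket t) J X (J X) = p * g0 X X.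
Proof.
move=> pos PX.
rewrite sqrt_bracket_chern_ricci_form -(hermitian_gE herm0).
have E : (1 - 2 * t * p) *: X = A t X.
  by rewrite -AE add_lfunE opp_lfunE scale_lfunE id_lfunE PX scalerA scalerBl
    scale1r.
have kP Z : k t (P0 Z) = P0 (k t Z).
  by rewrite -!(fcalc_eigen P_res) !(fcalcM P_res); congr (fun_of_lfun _ _);
    apply: eq_fcalc => i; rewrite mulrC.
have kkA Z : k t (k t (A t Z)) = Z.
  rewrite /sqrt_op_inv !(fcalcM P_res) -[RHS](fcalc1 P_res).
  congr (fun_of_lfun _ _); apply: eq_fcalc => i.
  by rewrite -(sqrt_coeff_sqr (pos i)) -invfM mulVf // mulf_neq0 // gt_eqF //
    sqrt_coeff_gt0.
have := bilZl gb (1 - 2 * t * p) (k t (P0 (k t X))) X; rewrite /= => <-.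
by rewrite -(linearZ_LR (k t)) -(linearZ_LR P0) -(linearZ_LR (k t)) /= E kP
  kkA PX (bilZl gb).
Qed.

(** A solution reaching T = 1/(2p) is bounded between 0 and T, so its Chern-Ricci form at (X, JX) is
    bounded by some [B]; the blow-up identity at time s T then gives q <= (1 - s) B for all s in [0,
    1). Writing times as s T treats both signs of [p] at once. *)
Lemma bracket_flow_stops (T1 T2 : \bar R) mu' p : (T1 < 0 < T2)%E ->
  bracket_flow br J om0 T1 T2 mu' ->
  p != 0 -> leigenvalue P0 p ->
  (forall t, 0 <= t < 1 ->
     (forall i, 0 < 1 - 2 * (t * (2 * p)^-1) * a i) /\
     forall X Y, mu' (t * (2 * p)^-1) X Y = sqrt_bracket (t * (2 * p)^-1) X Y) ->
  ~ (T1 < (2 * p)^-1%:E < T2)%E.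
Proof.
move=> T0 hf p0 /leigenvalueP[X X0 PX] agree Tin.
set T := (2 * p)^-1 in Tin agree.
have [M hM] := bracket_flow_bounded om_nd hf (fun s =>
  @between_in_interval _ _ _ _ s T0 Tin).
have lipPhi := loclip_chern_ricci_form J (loclip_vect_cst X) (loclip_vect_cst
  (J X)).
have [B B0 hB] := loclip_bounded M lipPhi.
pose q := `|p * g0 X X|.
have q0 : 0 < q.
  rewrite normr_gt0 mulf_neq0 // gt_eqF //.
  by case: g_ip => _ _; apply.
have main s : 0 <= s < 1 -> q <= (1 - s) * B.
  move=> s01; have [pos E] := agree s s01.
  rewrite /q -(sqrt_bracket_blow_up pos PX).
  rewrite (_ : 1 - 2 * (s * T) * p = 1 - s); last by rewrite /T; field.
  have /andP[s0 s1] := s01.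
  have d0 : 0 <= 1 - s by rewrite subr_ge0 ltW.
  rewrite normrM (ger0_norm d0) ler_wpM2l //.
  have sI : Num.min 0 T <= s * T <= Num.max 0 T.
    have [T00|T00] := leP 0 T.
      by rewrite mulr_ge0 //= ler_piMl // ltW.
    by apply/andP; split; nra.
  have -> : sqrt_bracket (s * T) = mu' (s * T).
    by apply/funext => U; apply/funext => W; rewrite E.
  apply: hB; last exact: hM.
  by have [_ /(_ _ (between_in_interval T0 Tin sI))[[]]] := hf.
have qB : 0 < q + B by rewrite ltr_pwDl.
(* With s = B / (q + B) one has 1 - s = q / (q + B), so the inequality becomes q + B <= B, against q
   > 0. *)
have := main (B / (q + B));
  rewrite divr_ge0 ?(ltW qB) //= ltr_pdivrMr // mul1r ltrDr.
move=> /(_ q0).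
rewrite (_ : 1 - B / (q + B) = q / (q + B)); last by field; rewrite gt_eqF.
rewrite mulrAC ler_pdivlMr // ler_pM2l // gerDr.
by rewrite leNgt q0.
Qed.

End FlowsOfHermitianStructure.

(** * Existence, uniqueness and maximality for both flows *)

Unset Implicit Arguments.

Theorem mainTheorem9 (R : realType) (n : nat) (V : vectType R)
    (br : V -> V -> V) (J : 'End(V)) (om0 g0 : V -> V -> R) (P0 : 'End(V))
    (dimV : \dim {:V} = (2 * n)%N)
    (br_lie : lie_bracket br)
    (herm0 : hermitian_structure br J om0 g0)
    (P0_cr : chern_ricci_operator br J om0 P0) :
  let om t X Y := om0 X Y - 2 * t * chern_ricci_form br J X Y in
  let g t X Y := om t X (J Y) in
  exists Tm Tp : \bar R,
    [/\ is_T_minus g0 P0 Tm, is_T_plus g0 P0 Tp & (Tm < 0 < Tp)%E] /\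
    [/\ (forall t X Y, om t X Y = om0 ((\1%VF - (2 * t) *: P0) X) Y),
        chern_ricci_flow br J om0 g0 Tm Tp om g &
        forall a b om' g', (a < 0 < b)%E ->
          chern_ricci_flow br J om0 g0 a b om' g' ->
          [/\ (Tm <= a)%E, (b <= Tp)%E &
              forall t, (a < t%:E < b)%E ->
                forall X Y, om' t X Y = om t X Y /\ g' t X Y = g t X Y]] /\
    exists h : R -> 'End(V),
      let mu t := gl_act (h t) br in
      [/\ (forall t, (Tm < t%:E < Tp)%E ->
             pos_sqrt g0 (\1%VF - (2 * t) *: P0) (h t) /\
             hermitian_structure (mu t) J om0 g0),
          bracket_flow br J om0 Tm Tp mu &
          forall a b mu', (a < 0 < b)%E ->
            bracket_flow br J om0 a b mu' ->
            [/\ (Tm <= a)%E, (b <= Tp)%E &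
                forall t, (a < t%:E < b)%E ->
                  forall X Y, mu' t X Y = mu t X Y]].
Proof.
move=> om g; have [om_nd g_ip _ _ _] := herm0.
have P0_sym := chern_ricci_operator_sym herm0 br_lie P0_cr.
have [m [a [pi [P_res pi_sym pi_comm]]]] :=
  symmetric_spectral_resolution g_ip P0_sym.
have pi_J i X : J (pi i X) = pi i (J X).
  by apply: pi_comm => Y; rewrite (chern_ricci_operator_J herm0 br_lie P0_cr).
have [Tp [isTp Tp0 goodp Tp_eig]] := maximal_time P_res g_ip pi_sym.
have [Tm [isTm Tm0 goodm Tm_eig]] := minimal_time P_res g_ip pi_sym.
have good t : (Tm < t%:E < Tp)%E -> forall i, 0 < 1 - 2 * t * a i.
  by move=> /andP[mt tp]; have [t0|/ltW t0] := leP 0 t;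
    [exact: goodp|exact: goodm].
exists Tm, Tp; split; first by split=> //; rewrite Tm0 Tp0.
(* Maximality for both flows: an interval going beyond [Tm] or [Tp] contains that finite endpoint,
   which is 1/(2p) for an eigenvalue [p]. The points s/(2p) with s in [0, 1) still lie in the
   existence interval. *)
have stop T1 T2 : (T1 < 0 < T2)%E ->
    (forall p, p != 0 -> leigenvalue P0 p ->
       (forall s, 0 <= s < 1 -> (Tm < (s * (2 * p)^-1)%:E < Tp)%E) ->
       ~ (T1 < (2 * p)^-1%:E < T2)%E) ->
    (Tm <= T1)%E /\ (T2 <= Tp)%E.
  move=> /andP[T10 T20] st; split; rewrite leNgt; apply/negP => lt1.
    case: Tm_eig => [Tme|[p [p0 Lp Tme]]];
      first by rewrite Tme ltNge leNye in lt1.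
    apply: (st p) => //; first by rewrite lt_eqF.
      move=> s /andP[s0 s1]; rewrite Tme in Tm0 *.
      have T0 : (2 * p)^-1 < 0 by rewrite -lte_fin.
      rewrite lte_fin; apply/andP; split; first nra.
      by apply: le_lt_trans Tp0; rewrite lee_fin; nra.
    by rewrite -Tme lt1 (lt_trans Tm0).
  case: Tp_eig => [Tpe|[p [p0 Lp Tpe]]]; first by rewrite Tpe ltNge leey in lt1.
  apply: (st p) => //; first by rewrite gt_eqF.
    move=> s /andP[s0 s1]; rewrite Tpe in Tp0 *.
    have T0 : 0 < (2 * p)^-1 by rewrite -lte_fin.
    rewrite lte_fin; apply/andP; split; last nra.
    by apply: lt_le_trans Tm0 _; rewrite lee_fin; nra.
  by rewrite -Tpe lt1 andbT (lt_trans T10).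
split.
  split.
  - by move=> t X Y; exact: affine_formE herm0 P0_cr t X Y.
  - exact: (affine_flow herm0 P0_cr P_res pi_sym pi_J good).
  - move=> T1 T2 om' g' T0 hf.
    have [//|TmT1 T2Tp] := stop T1 T2 T0.
      by move=> p p0 Lp _; exact: (chern_ricci_flow_stops herm0 P0_cr T0 hf p0
        Lp).
    by split=> // t tT X Y; exact: (chern_ricci_flow_uniq T0 hf tT X Y).
exists (sqrt_op a pi); split.
- move=> t /good pos; split;
  first exact: (sqrt_op_pos_sqrt herm0 P_res pi_sym pos).
  exact: (sqrt_bracket_hermitian herm0 P_res pi_J t).
- exact: (sqrt_bracket_flow br_lie herm0 P0_cr P_res pi_sym pi_J good).
move=> T1 T2 mu' T0 hf.
have flow := sqrt_bracket_flow br_lie herm0 P0_cr P_res pi_sym pi_J good.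
(* Uniqueness is applied on the intersection of the two intervals, since the inclusion of one in the
   other is not yet known and its proof uses this agreement. *)
have agree t : (T1 < t%:E < T2)%E -> (Tm < t%:E < Tp)%E ->
    forall X Y, mu' t X Y = gl_act (sqrt_op a pi t) br X Y.
  move=> /andP[h1 h2] /andP[h3 h4].
  have [T10 T20] := andP T0.
  apply: (bracket_flow_uniq om_nd (a := Order.max T1 Tm) (b := Order.min T2 Tp)
    (mu := mu') (nu := fun t => gl_act (sqrt_op a pi t) br)).
  - by rewrite gt_max lt_min T10 Tm0 T20 Tp0.
  - by apply: bracket_flow_restrict hf; rewrite ?le_max ?ge_min ?lexx.
  - by apply: bracket_flow_restrict flow; rewrite ?le_max ?ge_min ?lexx ?orbT.
  - by rewrite gt_max lt_min h1 h2 h3 h4.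
have [//|TmT1 T2Tp] := stop T1 T2 T0.
  move=> p p0 Lp inT Tin.
  apply: (bracket_flow_stops br_lie herm0 P0_cr P_res pi_sym pi_J T0 hf p0 Lp)
    (Tin) => s s01.
  split; first exact/good/inT.
  apply: agree; last exact: inT.
  apply: (between_in_interval T0 Tin).
  set T := (2 * p)^-1; have /andP[s0 s1] := s01.
  by have [T00|T00] := leP 0 T; apply/andP; split; nra.
split=> // t tT; apply: agree => //.
have /andP[h1 h2] := tT.
by rewrite (le_lt_trans TmT1) // (lt_le_trans h2).
Qed.
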